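(* Let $a\ge-1$ be real. With $G_a$ (defined for $a\ge-1$) and $g_a$ (defined for $a>0$) as in the context, the following hold for all real $x>0$: \begin{itemize} \item if $-1\le a<1$, then $\Gamma(a,x)<G_a(x)$; \item if $a=1$, then $g_a(x)=G_a(x)=\Gamma(a,x)=e^{-x}$; \item if $1<a<2$, then $g_a(x)<G_a(x)<\Gamma(a,x)$; \item if $a=2$, then $g_a(x)=G_a(x)=\Gamma(a,x)=e^{-x}(1+x)$; \item if $2<a<3$, then $\Gamma(a,x)<g_a(x)<G_a(x)$; \item if $a=3$, then $\Gamma(a,x)=g_a(x)=e^{-x}(2+2x+x^2)<G_a(x)$; \item if $a>3$, then $g_a(x)<\Gamma(a,x)<G_a(x)$. \end{itemize} Also, for each real $a\ge0$ the bound $G_a(x)$ on $\Gamma(a,x)$ is exact both at $x=0$ and at $x=\infty$. Further, for each real $a\ge1$ the bound $g_a(x)$ on $\Gamma(a,x)$ is exact both at $x=0$ and at $x=\infty$. Moreover, the bound $G_a(x)$ is exact at $x=\infty$ for each real $a\ge-1$.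
   Context: For real $a$ and real $x>0$, $\Gamma(a,x):=\int_x^\infty t^{a-1}e^{-t}\,dt$; $\Gamma(\cdot)$ with one argument is the usual gamma function. For real $a>-1$: $b_a:=\Gamma(a+1)^{1/(a-1)}$ if $a\ne1$, and $b_1:=e^{1-\gamma}$, where $\gamma=0.577\ldots$ is the Euler constant. For $a\ge-1$ and $x>0$: $G_a(x):=x^{-2}e^{-x}$ if $a=-1$; $G_a(x):=\frac{(x+b_a)^a-x^a}{a b_a}\,e^{-x}$ if $a\in(-1,\infty)\setminus\{0\}$; $G_a(x):=e^{-x}\ln\frac{x+1}{x}$ if $a=0$. For $a>0$ and $x>0$: $g_a(x):=\Big(\frac{(x+2)^a-x^a-2^a}{2a}+\Gamma(a)\Big)e^{-x}$. A bound $B_a(x)$ on $\Gamma(a,x)$ is called exact at $x=0$ if $B_a(x)/\Gamma(a,x)\to1$ as $x\downarrow0$, and exact at $x=\infty$ if $B_a(x)/\Gamma(a,x)\to1$ as $x\to\infty$. *)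

(* Defs.v *)
From Stdlib Require Export Reals.
From Coquelicot Require Export Coquelicot.
Open Scope R_scope.

(* [Rpower t y] is t^y for t > 0 only; every base below is positive on the
   range of parameters for which the definition is used. *)

(* Euler's integral: this is the gamma function for a > 0, the only range in
   which it is used. *)
Definition Gamma (a : R) : R :=
  RInt_gen (fun t => Rpower t (a - 1) * exp (- t))
           (at_right 0) (Rbar_locally p_infty).

(* Meaningful for every real a, and x > 0. *)
Definition uGamma (a x : R) : R :=
  RInt_gen (fun t => Rpower t (a - 1) * exp (- t))
           (at_point x) (Rbar_locally p_infty).

Definition euler_gamma : R :=
  real (Lim_seq (fun n => sum_n_m (fun k => / INR k) 1 n - ln (INR n))).

(* Meaningful for a > -1. *)
Definition b (a : R) : R :=
  if Req_EM_T a 1 then exp (1 - euler_gamma)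
  else Rpower (Gamma (a + 1)) (1 / (a - 1)).

(* Meaningful for a >= -1 and x > 0. *)
Definition G (a x : R) : R :=
  if Req_EM_T a (-1) then / x ^ 2 * exp (- x)
  else if Req_EM_T a 0 then exp (- x) * ln ((x + 1) / x)
  else (Rpower (x + b a) a - Rpower x a) / (a * b a) * exp (- x).

(* Meaningful for a > 0 and x > 0. *)
Definition g (a x : R) : R :=
  ((Rpower (x + 2) a - Rpower x a - Rpower 2 a) / (2 * a) + Gamma a)
  * exp (- x).

Definition exact_at_0 (a : R) (B : R -> R) : Prop :=
  filterlim (fun x => B x / uGamma a x) (at_right 0) (locally 1).

Definition exact_at_infty (a : R) (B : R -> R) : Prop :=
  filterlim (fun x => B x / uGamma a x) (Rbar_locally p_infty) (locally 1).

(* Main.v *)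
Require Import Defs.
From Stdlib Require Import Reals Lra.
From Coquelicot Require Import Coquelicot.
Open Scope R_scope.

(* Put p = a - 1, let T be a standard exponential variable and U_c a uniform one
   on [0, c]. Then
     e^x Gamma(a, x) = E (x + T)^p,   e^x G_a(x) = E (x + U_b)^p,
     e^x g_a(x) = E (x + U_2)^p - E U_2^p + E T^p,
   and b = b_a is chosen so that E U_b^p = E T^p. Likewise E U_2 = E T. The
   density of T minus that of U_c (c > 1) has the sign pattern +, -, + on
   (0, ln c), (ln c, c), (c, oo). Hence, if w is increasing and
   E w(T) = E w(U_c), then E f(T) > E f(U_c) for every f that is a strictly
   convex function of w: subtract from f the combination of 1 and w that agrees
   with it at ln c and c. Taking w = t^p / p compares Gamma(a, .) with G_a for
   a > 0, and taking w = t with f = (x + t)^p - t^p compares it with g_a for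
   a > 2. For -1 < a <= 0 one has b_a <= 1 and the two densities cross only
   once. The case w = t, f = t^p locates b_a with respect to 2, which decides
   between g_a and G_a, because e^x (G_a - g_a) = S(b_a) - S(2) for S(c) the
   mean over [0, c] of the monotone function (x + u)^p - u^p. *)

(** * Real powers *)

Lemma Rpower_pos (t p : R) : 0 < Rpower t p.
Proof. apply exp_pos. Qed.

Lemma exp_le_mono (x y : R) : x <= y -> exp x <= exp y.
Proof. intros [H | ->]; [left; now apply exp_increasing | apply Rle_refl]. Qed.

Lemma Rpower_pred (t p : R) : 0 < t -> t * Rpower t (p - 1) = Rpower t p.
Proof.
  intros Ht. rewrite <- (Rpower_1 t Ht) at 1.
  rewrite <- Rpower_plus. f_equal. ring.
Qed.

Lemma Rpower_base_decr (s t p : R) :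
  p < 0 -> 0 < s < t -> Rpower t p < Rpower s p.
Proof.
  intros Hp [Hs Hst]. apply exp_increasing.
  assert (ln s < ln t) by (apply ln_increasing; lra). nra.
Qed.

Lemma Rpower_INR_pow (t p : R) (n : nat) : 0 < t -> p = INR n -> Rpower t p = t ^ n.
Proof. intros Ht ->. now apply Rpower_pow. Qed.

Lemma is_derive_Rpower_shift (x p t : R) :
  0 < x + t ->
  is_derive (fun s => Rpower (x + s) p) t (p * Rpower (x + t) (p - 1)).
Proof.
  intros H. unfold Rpower at 1. auto_derive; [lra|].
  fold (Rpower (x + t) p). rewrite <- (Rpower_pred (x + t) p H). field. lra.
Qed.

Lemma is_derive_Rpower (p t : R) :
  0 < t -> is_derive (fun s => Rpower s p) t (p * Rpower t (p - 1)).
Proof. intros H. apply is_derive_Reals. now apply derivable_pt_lim_power. Qed.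

Lemma continuous_ex_derive (f : R -> R) (x : R) : ex_derive f x -> continuous f x.
Proof. apply (ex_derive_continuous (V := R_NormedModule)). Qed.

Lemma is_derive_continuous (f : R -> R) (t l : R) :
  is_derive f t l -> continuous f t.
Proof. intros H. apply continuous_ex_derive. now exists l. Qed.

Lemma continuous_Rpower_shift (x p t : R) :
  0 < x + t -> continuous (fun s => Rpower (x + s) p) t.
Proof. intros H. eapply is_derive_continuous, is_derive_Rpower_shift, H. Qed.

Lemma continuous_Rpower (p t : R) : 0 < t -> continuous (fun s => Rpower s p) t.
Proof. intros H. eapply is_derive_continuous, is_derive_Rpower, H. Qed.

Lemma continuous_expN (t : R) : continuous (fun s => exp (- s)) t.
Proof. apply continuous_ex_derive. auto_derive. exact I. Qed.

Lemma continuous_exp_weight (f : R -> R) (t : R) :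
  continuous f t -> continuous (fun s => f s * exp (- s)) t.
Proof. intros H. apply (continuous_mult (K := R_AbsRing)); [exact H | apply continuous_expN]. Qed.

Lemma pos_derive_incr (f df : R -> R) :
  (forall t, 0 < t -> is_derive f t (df t)) -> (forall t, 0 < t -> 0 < df t) ->
  forall s t, 0 < s -> s < t -> f s < f t.
Proof.
  intros Hd Hp s t Hs Hst.
  apply (incr_function f 0 p_infty df); simpl; auto.
  intros r Hr _. now apply Hp.
Qed.

Lemma filterlim_Rpower_0 (p : R) :
  0 < p -> filterlim (fun t => Rpower t p) (at_right 0) (locally 0).
Proof.
  intros Hp. unfold Rpower.
  apply (filterlim_comp _ _ _ (fun t => p * ln t) exp _ (Rbar_locally m_infty)).
  - apply (filterlim_comp _ _ _ ln (Rmult p) _ (Rbar_locally m_infty)).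
    + apply is_lim_ln_0.
    + pose proof (filterlim_Rbar_mult_l p m_infty) as H.
      replace (Rbar_mult p m_infty) with m_infty in H; [exact H|].
      simpl. destruct (Rle_dec 0 p) as [H'|H']; [|lra].
      destruct (Rle_lt_or_eq_dec 0 p H'); [reflexivity|lra].
  - apply is_lim_exp_m.
Qed.

Lemma continuous_at_right (f : R -> R) (x : R) :
  continuous f x -> filterlim f (at_right x) (locally (f x)).
Proof. intros H. eapply filterlim_filter_le_1; [|exact H]. apply filter_le_within. Qed.

(* From [ln y <= ln (2 P) + y / (2 P)] with [P = max p 1]. *)
Lemma Rpower_exp_bound (p : R) :
  exists C, 0 < C /\
    forall y, 1 <= y -> Rpower y p * exp (- y) <= C * exp (- y / 2).
Proof.
  pose (P := Rmax p 1).
  assert (HP1 : 1 <= P) by apply Rmax_r. assert (HPp : p <= P) by apply Rmax_l.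
  exists (exp (P * ln (2 * P))). split; [apply exp_pos|].
  intros y Hy. unfold Rpower. rewrite <- !exp_plus.
  assert (Hln : ln y <= ln (2 * P) + y / (2 * P)).
  { replace y with ((2 * P) * (y / (2 * P))) at 1 by (field; lra).
    assert (0 < y / (2 * P)) by (apply Rdiv_lt_0_compat; lra).
    rewrite ln_mult by lra.
    assert (ln (y / (2 * P)) < y / (2 * P)); [|lra].
    apply exp_lt_inv. rewrite exp_ln by assumption.
    pose proof (exp_ineq1 (y / (2 * P))). lra. }
  assert (Hln0 : 0 <= ln y) by (rewrite <- ln_1; apply ln_le; lra).
  assert (Hm : P * ln y <= P * ln (2 * P) + y / 2).
  { replace (P * ln (2 * P) + y / 2) with (P * (ln (2 * P) + y / (2 * P))) by (field; lra).
    apply Rmult_le_compat_l; lra. }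
  assert (H : p * ln y + - y <= P * ln (2 * P) + - y / 2) by nra.
  now apply exp_le_mono.
Qed.

(** A squeeze: for [t > 1] the bound of [Rpower_exp_bound] at [y = x + t], multiplied by [exp x],
    dominates the function by a multiple of [exp (- t / 2)]. *)
Lemma filterlim_Rpower_exp_infty (x p : R) :
  0 <= x ->
  filterlim (fun t => Rpower (x + t) p * exp (- t)) (Rbar_locally p_infty) (locally 0).
Proof.
  intros Hx. destruct (Rpower_exp_bound p) as [C [HC H]].
  assert (Hlim : is_lim (fun t => exp x * C * exp (- / 2 * t)) p_infty 0).
  { replace (Finite 0) with (Rbar_mult (exp x * C) 0) by (simpl; f_equal; ring).
    apply is_lim_scal_l.
    apply (is_lim_comp exp (fun t => - / 2 * t) p_infty 0 m_infty).
    - apply is_lim_exp_m.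
    - replace m_infty with (Rbar_mult (- / 2) p_infty).
      + apply is_lim_scal_l, is_lim_id.
      + simpl. destruct (Rle_dec 0 (- / 2)); [exfalso; lra | reflexivity].
    - exists 0. intros; discriminate. }
  apply (is_lim_le_le_loc (fun _ => 0) (fun t => exp x * C * exp (- / 2 * t))
           (fun t => Rpower (x + t) p * exp (- t)) p_infty 0);
    [| apply is_lim_const | exact Hlim].
  exists 1. intros t Ht. split.
  - pose proof (Rpower_pos (x + t) p). pose proof (exp_pos (- t)). nra.
  - specialize (H (x + t) ltac:(lra)).
    replace (exp (- t)) with (exp x * exp (- (x + t)))
      by (rewrite <- exp_plus; f_equal; ring).
    assert (exp (- (x + t) / 2) <= exp (- / 2 * t)) by (apply exp_le_mono; lra).
    pose proof (exp_pos x).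
    apply Rle_trans with (exp x * (C * exp (- (x + t) / 2))); [nra|].
    rewrite Rmult_assoc. apply Rmult_le_compat_l; nra.
Qed.

(** * Improper integrals on (0, oo) *)

(** The fundamental theorem of calculus with limits of [A] in place of end values. The end filters
    stay abstract so that one statement serves both (0, oo) and (0, b]. *)
Lemma is_RInt_gen_antiderivative (Fa Fb : (R -> Prop) -> Prop) (c : R)
  (A f : R -> R) (la lb : R) :
  Filter Fa -> Filter Fb ->
  Fa (fun u => c < u) -> Fb (fun v => c < v) ->
  (forall t, c < t -> is_derive A t (f t)) ->
  (forall t, c < t -> continuous f t) ->
  filterlim A Fa (locally la) -> filterlim A Fb (locally lb) ->
  is_RInt_gen f Fa Fb (lb - la).
Proof.
  intros FFa FFb Ha Hb Hd Hc Hla Hlb.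
  assert (Hder : forall t, c < t -> Derive A t = f t)
    by (intros t Ht; now apply is_derive_unique, Hd).
  assert (Hmin : filter_prod Fa Fb (fun ab => c < Rmin (fst ab) (snd ab))).
  { exists (fun u => c < u) (fun v => c < v); auto.
    intros u v Hu Hv. now apply Rmin_glb_lt. }
  apply (is_RInt_gen_ext (Derive A)).
  { eapply filter_imp; [|exact Hmin]. intros [u v] H t [Ht _].
    simpl in *. apply Hder. lra. }
  apply is_RInt_gen_Derive; auto.
  - eapply filter_imp; [|exact Hmin]. intros [u v] H t [Ht _]. simpl in *.
    exists (f t). apply Hd. lra.
  - eapply filter_imp; [|exact Hmin]. intros [u v] H t [Ht _]. simpl in *.
    assert (c < t) by lra.
    (* Continuity of [Derive A] is required, but it is known to coincide with [f] only to the right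
       of [c]; the ball of radius [t - c] stays there. *)
    apply (continuous_ext_loc (Derive A) f t).
    + exists (mkposreal (t - c) ltac:(lra)). intros s Hs.
      apply Rabs_lt_between' in Hs. simpl in Hs. symmetry. apply Hder. lra.
    + now apply Hc.
Qed.

Lemma at_right_gt (x : R) : at_right x (fun u => x < u).
Proof. exists (mkposreal 1 Rlt_0_1). auto. Qed.

Lemma infty_gt (c : R) : Rbar_locally p_infty (fun v => c < v).
Proof. exists c. auto. Qed.

Lemma at_right_lt (x c : R) : x < c -> at_right x (fun u => u < c).
Proof.
  intros H. exists (mkposreal (c - x) ltac:(lra)). intros u Hu _.
  apply Rabs_lt_between' in Hu. simpl in Hu. lra.
Qed.

Lemma ex_RInt_pos (f : R -> R) (u v : R) :
  (forall t, 0 < t -> continuous f t) -> 0 < u -> 0 < v -> ex_RInt f u v.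
Proof.
  intros Hc Hu Hv. apply (ex_RInt_continuous (V := R_CompleteNormedModule)).
  intros t [Ht _]. apply Hc.
  eapply Rlt_le_trans; [|exact Ht]. now apply Rmin_glb_lt.
Qed.

Notation is_int0 f l := (is_RInt_gen f (at_right 0) (Rbar_locally p_infty) l).

(** Continuity on (0, oo) makes every partial integral exist, so the product filter unfolds into an
    epsilon statement about the total function [RInt]. The clause [0 < v] guards against a negative
    [M]. *)
Lemma is_int0_eps (f : R -> R) (l : R) :
  (forall t, 0 < t -> continuous f t) ->
  is_int0 f l <->
  (forall eps, 0 < eps -> exists d M, 0 < d /\
     forall u v, 0 < u < d -> M < v -> 0 < v -> Rabs (RInt f u v - l) < eps).
Proof.
  intros Hc. split.
  - intros H eps Heps.
    destruct (H (fun y => Rabs (y - l) < eps)) as [Q P [d Hd] [M HM] HQP].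
    { exists (mkposreal eps Heps). intros y Hy. exact Hy. }
    exists d, M. split; [apply cond_pos|]. intros u v Hu Hv Hv0.
    destruct (HQP u v) as [y [Hy1 Hy2]].
    + apply Hd; [|lra]. apply Rabs_lt_between'. simpl. lra.
    + now apply HM.
    + simpl in Hy1. now rewrite (is_RInt_unique _ _ _ _ Hy1).
  - intros H P [eps HP]. destruct (H eps (cond_pos eps)) as [d [M [Hd HM]]].
    exists (fun u => 0 < u < d) (fun v => M < v /\ 0 < v).
    + exists (mkposreal d Hd). intros u Hu Hu0.
      apply Rabs_lt_between' in Hu. simpl in Hu. lra.
    + exists (Rmax M 0). intros v Hv. split.
      * eapply Rle_lt_trans; [apply Rmax_l|exact Hv].
      * eapply Rle_lt_trans; [apply Rmax_r|exact Hv].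
    + intros u v Hu [Hv Hv0]. exists (RInt f u v). simpl. split.
      * apply (RInt_correct (V := R_CompleteNormedModule)), ex_RInt_pos; lra || auto.
      * apply HP. now apply HM.
Qed.

Lemma RInt_mono_bounds (f : R -> R) (u u' v' v : R) :
  (forall t, 0 < t -> continuous f t) -> (forall t, 0 < t -> 0 <= f t) ->
  0 < u -> u <= u' -> u' <= v' -> v' <= v -> RInt f u' v' <= RInt f u v.
Proof.
  intros Hc Hp Hu H1 H2 H3.
  assert (E : forall s t, 0 < s -> 0 < t -> ex_RInt f s t) by (intros; now apply ex_RInt_pos).
  rewrite <- (RInt_Chasles f u u' v), <- (RInt_Chasles f u' v' v) by (apply E; lra).
  unfold plus; simpl.
  assert (0 <= RInt f u u').
  { apply RInt_ge_0; [lra|apply E; lra|]. intros; apply Hp; lra. }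
  assert (0 <= RInt f v' v); [|lra].
  apply RInt_ge_0; [lra|apply E; lra|]. intros; apply Hp; lra.
Qed.

Lemma is_int0_ge_RInt (f : R -> R) (l u v : R) :
  (forall t, 0 < t -> continuous f t) -> (forall t, 0 < t -> 0 <= f t) ->
  is_int0 f l -> 0 < u -> u <= v -> RInt f u v <= l.
Proof.
  intros Hc Hp Hl Hu Huv. apply le_epsilon. intros eps Heps.
  rewrite is_int0_eps in Hl by exact Hc.
  destruct (Hl eps Heps) as [d [M [Hd H]]].
  pose (u' := Rmin u d / 2). pose (v' := Rmax v M + 1).
  assert (0 < Rmin u d) by (apply Rmin_glb_lt; lra).
  pose proof (Rmin_l u d). pose proof (Rmin_r u d).
  pose proof (Rmax_l v M). pose proof (Rmax_r v M).
  specialize (H u' v' ltac:(unfold u'; lra) ltac:(unfold v'; lra) ltac:(unfold v'; lra)).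
  apply Rabs_lt_between' in H.
  pose proof (RInt_mono_bounds f u' u v v' Hc Hp ltac:(unfold u'; lra)
    ltac:(unfold u'; lra) Huv ltac:(unfold v'; lra)). lra.
Qed.

(** Partial integrals of a nonnegative function grow with the interval, so their supremum is the
    improper integral. *)
Lemma ex_int0_of_bounded (f : R -> R) (B1 B2 : R) :
  (forall t, 0 < t -> continuous f t) -> (forall t, 0 < t -> 0 <= f t) ->
  (forall u, 0 < u < 1 -> RInt f u 1 <= B1) ->
  (forall v, 1 < v -> RInt f 1 v <= B2) ->
  exists l, is_int0 f l.
Proof.
  intros Hc Hp H1 H2.
  destruct (completeness (fun y => exists u v, 0 < u < 1 /\ 1 < v /\ y = RInt f u v))
    as [l [Hub Hlub]].
  - exists (B1 + B2). intros y [u [v [Hu [Hv ->]]]].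
    rewrite <- (RInt_Chasles f u 1 v) by (apply ex_RInt_pos; lra || auto).
    unfold plus; simpl. specialize (H1 u Hu). specialize (H2 v Hv). lra.
  - exists (RInt f (/ 2) 2). exists (/ 2), 2. repeat split; lra.
  - exists l. apply is_int0_eps; [exact Hc|]. intros eps Heps.
    (* Either some partial integral exceeds [l - eps], and then so do all those over larger
       intervals, or [l - eps] would be a smaller upper bound. *)
    destruct (Classical_Prop.classic
      (exists u v, 0 < u < 1 /\ 1 < v /\ l - eps < RInt f u v)) as [E|E].
    + destruct E as [u0 [v0 [Hu0 [Hv0 E]]]]. exists u0, v0. split; [lra|].
      intros u v Hu Hv _. apply Rabs_lt_between'. split.
      * eapply Rlt_le_trans; [exact E|]. apply RInt_mono_bounds; lra || auto.
      * apply Rle_lt_trans with l; [|lra]. apply Hub. exists u, v. repeat split; lra.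
    + exfalso. assert (l <= l - eps); [|lra]. apply Hlub.
      intros y [u [v [Hu [Hv ->]]]].
      destruct (Rle_or_lt (RInt f u v) (l - eps)) as [|C]; [assumption|].
      exfalso. apply E. exists u, v. auto.
Qed.

(** * Means under the exponential law and the gamma function *)

(** The expectation of [f] under the standard exponential law. Being a relation, it carries the
    convergence of the integral. *)
Definition is_exp_mean (f : R -> R) (l : R) : Prop :=
  is_int0 (fun t => f t * exp (- t)) l.

Lemma is_exp_mean_unique (f : R -> R) (l m : R) :
  is_exp_mean f l -> is_exp_mean f m -> l = m.
Proof.
  intros Hl Hm.
  rewrite <- (is_RInt_gen_unique (V := R_CompleteNormedModule) _ _ Hl).
  apply (is_RInt_gen_unique (V := R_CompleteNormedModule) _ _ Hm).
Qed.

Lemma pos_filter (Fb : (R -> Prop) -> Prop) :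
  Filter Fb -> Fb (fun v => 0 < v) ->
  filter_prod (at_right 0) Fb (fun ab => 0 < Rmin (fst ab) (snd ab)).
Proof.
  intros FF HF. exists (fun u => 0 < u) (fun v => 0 < v).
  - apply at_right_gt.
  - exact HF.
  - intros u v Hu Hv. now apply Rmin_glb_lt.
Qed.

Lemma is_RInt_gen_ext_pos (Fb : (R -> Prop) -> Prop) (f h : R -> R) (l : R) :
  Filter Fb -> Fb (fun v => 0 < v) ->
  (forall t, 0 < t -> f t = h t) ->
  is_RInt_gen f (at_right 0) Fb l -> is_RInt_gen h (at_right 0) Fb l.
Proof.
  intros FF HF H. apply is_RInt_gen_ext.
  eapply filter_imp; [|now apply pos_filter].
  intros [u v] Huv t [Ht _]. simpl in *. apply H. lra.
Qed.

Lemma is_exp_mean_ext (f h : R -> R) (l : R) :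
  (forall t, 0 < t -> f t = h t) -> is_exp_mean f l -> is_exp_mean h l.
Proof.
  intros H.
  apply (is_RInt_gen_ext_pos _ (fun t => f t * exp (- t)) (fun t => h t * exp (- t))).
  - apply Rbar_locally_filter.
  - apply infty_gt.
  - intros t Ht. now rewrite H.
Qed.

Lemma is_exp_mean_plus (f h : R -> R) (l m : R) :
  is_exp_mean f l -> is_exp_mean h m -> is_exp_mean (fun t => f t + h t) (l + m).
Proof.
  intros Hl Hm. unfold is_exp_mean.
  eapply is_RInt_gen_ext_pos; [apply Rbar_locally_filter | apply infty_gt | |
    exact (is_RInt_gen_plus _ _ _ _ Hl Hm)].
  intros t _. unfold plus; simpl. ring.
Qed.

Lemma is_exp_mean_scal (k : R) (f : R -> R) (l : R) :
  is_exp_mean f l -> is_exp_mean (fun t => k * f t) (k * l).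
Proof.
  intros Hl. unfold is_exp_mean.
  eapply is_RInt_gen_ext_pos; [apply Rbar_locally_filter | apply infty_gt | |
    exact (is_RInt_gen_scal _ k _ Hl)].
  intros t _. unfold scal; simpl. unfold mult; simpl. ring.
Qed.

Lemma is_exp_mean_minus (f h : R -> R) (l m : R) :
  is_exp_mean f l -> is_exp_mean h m -> is_exp_mean (fun t => f t - h t) (l - m).
Proof.
  intros Hl Hm. replace (l - m) with (l + -1 * m) by ring.
  eapply is_exp_mean_ext; [|exact (is_exp_mean_plus _ _ _ _ Hl (is_exp_mean_scal (-1) _ _ Hm))].
  intros t _; simpl; ring.
Qed.

Lemma is_lim_expN : filterlim (fun t => exp (- t)) (Rbar_locally p_infty) (locally 0).
Proof.
  eapply filterlim_ext_loc; [|exact (filterlim_Rpower_exp_infty 0 0 (Rle_refl 0))].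
  exists 0. intros t Ht. rewrite Rplus_0_l, Rpower_O by assumption. ring.
Qed.

Lemma is_exp_mean_1 : is_exp_mean (fun _ => 1) 1.
Proof.
  assert (H : is_exp_mean (fun _ => 1) (0 - - exp (- 0)));
    [|rewrite Ropp_0, exp_0 in H; now replace (0 - - (1)) with 1 in H by ring].
  unfold is_exp_mean. apply (is_RInt_gen_antiderivative _ _ 0 (fun t => - exp (- t))).
  - typeclasses eauto.
  - typeclasses eauto.
  - apply at_right_gt.
  - apply infty_gt.
  - intros t _. auto_derive; [exact I | ring].
  - intros t _. apply continuous_exp_weight, continuous_const.
  - apply (continuous_at_right (fun t => - exp (- t))).
    apply continuous_ex_derive. auto_derive. exact I.
  - replace 0 with (opp 0) by (unfold opp; simpl; ring).
    eapply filterlim_comp; [exact is_lim_expN|]. apply (filterlim_opp (V := R_NormedModule)).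
Qed.

Lemma is_exp_mean_const (c : R) : is_exp_mean (fun _ => c) c.
Proof.
  replace c with (c * 1) by ring. apply (is_exp_mean_scal c (fun _ => 1)), is_exp_mean_1.
Qed.

(** Strictness comes from the interval [1, 2], whose contribution is already positive and bounds the
    whole integral from below. *)
Lemma is_exp_mean_pos (f : R -> R) (l : R) :
  (forall t, 0 < t -> continuous f t) -> (forall t, 0 < t -> 0 < f t) ->
  is_exp_mean f l -> 0 < l.
Proof.
  intros Hc Hp Hl.
  assert (Hp' : forall t, 0 < t -> 0 < f t * exp (- t)).
  { intros t Ht. apply Rmult_lt_0_compat; [now apply Hp | apply exp_pos]. }
  assert (Hc' : forall t, 0 < t -> continuous (fun t => f t * exp (- t)) t)
    by (intros; apply continuous_exp_weight; auto).
  apply Rlt_le_trans with (RInt (fun t => f t * exp (- t)) 1 2).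
  - apply RInt_gt_0; [lra | |]; intros; [apply Hp' | apply Hc']; lra.
  - apply is_int0_ge_RInt; try lra; auto. intros; now apply Rlt_le, Hp'.
Qed.

Lemma is_exp_mean_lt (f h : R -> R) (l m : R) :
  (forall t, 0 < t -> continuous f t) -> (forall t, 0 < t -> continuous h t) ->
  (forall t, 0 < t -> f t < h t) ->
  is_exp_mean f l -> is_exp_mean h m -> l < m.
Proof.
  intros Hf Hh H Hl Hm. assert (0 < m - l); [|lra].
  apply (is_exp_mean_pos (fun t => h t - f t)).
  - intros t Ht. apply (continuous_minus (V := R_NormedModule)); auto.
  - intros t Ht. specialize (H t Ht). lra.
  - now apply is_exp_mean_minus.
Qed.

(** The integrand is the derivative of [- (Rpower (x + t) p * exp (- t))]. The boundary value [x0]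
    is given as a right limit because [Rpower] is not a power at base 0; [x = 0] yields the
    recurrence of [Gamma], and [0 < x] that of [uGamma]. *)
Lemma is_exp_mean_by_parts (x p x0 : R) :
  0 <= x ->
  filterlim (fun t => Rpower (x + t) p) (at_right 0) (locally x0) ->
  is_exp_mean (fun t => Rpower (x + t) p - p * Rpower (x + t) (p - 1)) x0.
Proof.
  intros Hx H0. replace x0 with (0 - - x0) by ring.
  unfold is_exp_mean.
  apply (is_RInt_gen_antiderivative _ _ 0 (fun t => - (Rpower (x + t) p * exp (- t)))).
  - typeclasses eauto.
  - typeclasses eauto.
  - apply at_right_gt.
  - apply infty_gt.
  - intros t Ht.
    replace ((Rpower (x + t) p - p * Rpower (x + t) (p - 1)) * exp (- t))
      with (opp (plus (mult (p * Rpower (x + t) (p - 1)) (exp (- t)))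
                      (mult (Rpower (x + t) p) (- exp (- t)))))
      by (unfold opp, plus, mult; simpl; ring).
    apply @is_derive_opp.
    apply (is_derive_mult (fun t => Rpower (x + t) p) (fun t => exp (- t))).
    + apply is_derive_Rpower_shift. lra.
    + auto_derive; [exact I | ring].
    + intros; apply Rmult_comm.
  - intros t Ht. apply continuous_exp_weight.
    apply (continuous_minus (V := R_NormedModule)).
    + apply continuous_Rpower_shift. lra.
    + apply (continuous_scal_r (V := R_NormedModule) p). apply continuous_Rpower_shift. lra.
  - replace (- x0) with (opp (mult x0 (exp (- 0)))).
    2:{ unfold opp, mult; simpl. rewrite Ropp_0, exp_0. ring. }
    eapply filterlim_comp; [|apply (filterlim_opp (V := R_NormedModule))].
    eapply filterlim_comp_2; [exact H0 | | apply (filterlim_mult (K := R_AbsRing))].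
    apply (continuous_at_right (fun t => exp (- t))), continuous_expN.
  - replace 0 with (opp 0) by (unfold opp; simpl; ring).
    eapply filterlim_comp; [now apply filterlim_Rpower_exp_infty|].
    apply (filterlim_opp (V := R_NormedModule)).
Qed.

(** Convergence is checked separately on (0, 1), where only [x = 0] is singular, and on (1, oo),
    where the exponential wins. *)
Lemma ex_exp_mean_Rpower_shift (x p : R) :
  0 < x \/ x = 0 /\ -1 < p ->
  exists l, is_exp_mean (fun t => Rpower (x + t) p) l.
Proof.
  intros Hxp. assert (Hx : 0 <= x) by (destruct Hxp; lra).
  assert (Hc : forall t, 0 < t -> continuous (fun t => Rpower (x + t) p * exp (- t)) t).
  { intros t Ht. apply continuous_exp_weight, continuous_Rpower_shift. lra. }
  assert (Hp : forall t, 0 < t -> 0 <= Rpower (x + t) p * exp (- t)).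
  { intros t _. left. apply Rmult_lt_0_compat; [apply Rpower_pos | apply exp_pos]. }
  assert (Hle : forall t, 0 < t -> Rpower (x + t) p * exp (- t) <= Rpower (x + t) p).
  { intros t Ht. pose proof (Rpower_pos (x + t) p).
    assert (exp (- t) < 1); [|nra]. rewrite <- exp_0. apply exp_increasing. lra. }
  assert (B1 : exists B, forall u, 0 < u < 1 ->
            RInt (fun t => Rpower (x + t) p * exp (- t)) u 1 <= B).
  { destruct Hxp as [Hx'|[-> Hp']].
    (* A power is monotone in its base, in a direction that depends on the sign of [p]; the sum of
       both end values covers either case. *)
    - exists (Rpower x p + Rpower (x + 1) p). intros u Hu.
      pose proof (Rpower_pos x p). pose proof (Rpower_pos (x + 1) p).
      apply Rle_trans with (RInt (fun _ => Rpower x p + Rpower (x + 1) p) u 1).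
      + apply RInt_le; [lra | apply ex_RInt_pos; lra || auto | apply ex_RInt_const |].
        intros t Ht. eapply Rle_trans; [apply Hle; lra|].
        destruct (Rle_or_lt 0 p) as [H1|H1].
        * assert (Rpower (x + t) p <= Rpower (x + 1) p); [apply Rle_Rpower_l; lra | lra].
        * pose proof (Rpower_base_decr x (x + t) p H1 ltac:(lra)). lra.
      + rewrite RInt_const. unfold scal; simpl. unfold mult; simpl. nra.
    (* This is the integral of t^p over (0, 1). *)
    - exists (/ (p + 1)). intros u Hu.
      apply Rle_trans with (RInt (fun t => Rpower t p) u 1).
      + apply RInt_le; [lra | apply ex_RInt_pos; lra || auto | |].
        * apply ex_RInt_pos; try lra. intros t Ht. now apply continuous_Rpower.
        * intros t Ht. eapply Rle_trans; [apply Hle; lra|]. rewrite Rplus_0_l. lra.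
      + erewrite is_RInt_unique.
        2:{ apply (is_RInt_derive (fun t => / (p + 1) * Rpower t (p + 1))).
            - intros t Ht. rewrite Rmin_left in Ht by lra.
              evar_last.
              + apply is_derive_scal, is_derive_Rpower. lra.
              + replace (p + 1 - 1) with p by ring. field. lra.
            - intros t Ht. rewrite Rmin_left in Ht by lra. apply continuous_Rpower. lra. }
        unfold minus, plus, opp; simpl. unfold Rpower at 1. rewrite ln_1, Rmult_0_r, exp_0.
        assert (0 < / (p + 1)) by (apply Rinv_0_lt_compat; lra).
        pose proof (Rpower_pos u (p + 1)). nra. }
  destruct B1 as [B1 HB1]. destruct (Rpower_exp_bound p) as [C [HC HCb]].
  (* The second bound is the integral of [exp x * C * exp (- t / 2)] over (0, oo). *)
  apply (ex_int0_of_bounded _ B1 (2 * (exp x * C))); auto.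
  intros v Hv.
  apply Rle_trans with (RInt (fun t => exp x * C * exp (- t / 2)) 1 v).
  - apply RInt_le; [lra | apply ex_RInt_pos; lra || auto | |].
    + apply ex_RInt_pos; try lra. intros t _.
      apply continuous_ex_derive. auto_derive. exact I.
    + intros t Ht. specialize (HCb (x + t) ltac:(lra)).
      replace (exp (- t)) with (exp x * exp (- (x + t)))
        by (rewrite <- exp_plus; f_equal; ring).
      assert (exp (- (x + t) / 2) <= exp (- t / 2)) by (apply exp_le_mono; lra).
      pose proof (exp_pos x).
      apply Rle_trans with (exp x * (C * exp (- (x + t) / 2))); [nra|].
      rewrite Rmult_assoc. apply Rmult_le_compat_l; nra.
  - erewrite is_RInt_unique.
    2:{ apply (is_RInt_derive (fun t => -2 * (exp x * C) * exp (- t / 2))).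
        - intros t _. auto_derive; [exact I|]. unfold Rdiv. field.
        - intros t _. apply continuous_ex_derive. auto_derive. exact I. }
    unfold minus, plus, opp; simpl.
    pose proof (exp_pos (- v / 2)). pose proof (exp_pos x).
    pose proof (exp_increasing (- (1) / 2) 0 ltac:(lra)) as He. rewrite exp_0 in He.
    assert (0 < exp x * C) by nra. nra.
Qed.

(** The exponent is a separate variable tied by an equation, so that exponents such as 0, or [a] for
    [Gamma (a + 1)], need no rewriting. *)
Lemma is_exp_mean_Gamma (a p : R) :
  p = a - 1 -> 0 < a -> is_exp_mean (fun t => Rpower t p) (Gamma a).
Proof.
  intros -> Ha. destruct (ex_exp_mean_Rpower_shift 0 (a - 1)) as [l Hl]; [right; lra|].
  assert (H : is_exp_mean (fun t => Rpower t (a - 1)) l).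
  { eapply is_exp_mean_ext; [|exact Hl]. intros t _; simpl. now rewrite Rplus_0_l. }
  unfold is_exp_mean in *. unfold Gamma.
  apply (RInt_gen_correct (V := R_CompleteNormedModule)). now exists l.
Qed.

(** Gives access to the definition once it has been made opaque. *)
Lemma is_exp_mean_int0 (f : R -> R) (l : R) :
  is_exp_mean f l -> is_int0 (fun t => f t * exp (- t)) l.
Proof. exact (fun H => H). Qed.

(* A transparent [is_exp_mean] unfolds to a [forall], on which [apply] diverges. *)
Global Opaque is_exp_mean.

Lemma Gamma_pos (a : R) : 0 < a -> 0 < Gamma a.
Proof.
  intros Ha. apply (is_exp_mean_pos (fun t => Rpower t (a - 1))).
  - intros t Ht. now apply continuous_Rpower.
  - intros t _. apply Rpower_pos.
  - now apply is_exp_mean_Gamma.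
Qed.

Lemma Gamma_1 : Gamma 1 = 1.
Proof.
  apply (is_exp_mean_unique (fun t => Rpower t 0)).
  - apply is_exp_mean_Gamma; lra.
  - eapply is_exp_mean_ext; [|exact is_exp_mean_1].
    intros t Ht. symmetry. now apply Rpower_O.
Qed.

Lemma Gamma_succ (a : R) : 0 < a -> Gamma (a + 1) = a * Gamma a.
Proof.
  intros Ha. assert (H : Gamma (a + 1) - a * Gamma a = 0); [|lra].
  apply (is_exp_mean_unique (fun t => Rpower t a - a * Rpower t (a - 1))).
  - apply is_exp_mean_minus.
    + apply is_exp_mean_Gamma; lra.
    + now apply is_exp_mean_scal, is_exp_mean_Gamma.
  - eapply is_exp_mean_ext; [|apply (is_exp_mean_by_parts 0 a 0); [lra|]].
    + intros t _; simpl. now rewrite Rplus_0_l.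
    + eapply filterlim_ext; [|exact (filterlim_Rpower_0 a Ha)].
      intros t; simpl. now rewrite Rplus_0_l.
Qed.

Lemma Gamma_2 : Gamma 2 = 1.
Proof. replace 2 with (1 + 1) by ring. rewrite Gamma_succ, Gamma_1 by lra. ring. Qed.

Lemma is_exp_mean_id : is_exp_mean (fun t => t) 1.
Proof.
  rewrite <- Gamma_2. apply (is_exp_mean_ext (fun t => Rpower t 1)).
  - intros t Ht. now apply Rpower_1.
  - apply is_exp_mean_Gamma; lra.
Qed.

(** * Exponential against uniform means *)

(** In the notation of the overview, [k] is E f(T) - E f(U_b). The uniform mean is improper at 0
    because [f] may behave there like t^(a-1) with a < 1. *)
Definition mean_gap (b : R) (f : R -> R) (k : R) : Prop :=
  exists l m : R, is_exp_mean f l /\ is_RInt_gen f (at_right 0) (at_point b) m /\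
    k = l - m / b.

Lemma mean_gap_antiderivative (b : R) (A f : R -> R) (A0 l k : R) :
  0 < b ->
  (forall t, 0 < t -> is_derive A t (f t)) ->
  (forall t, 0 < t -> continuous f t) ->
  filterlim A (at_right 0) (locally A0) ->
  is_exp_mean f l -> k = l - (A b - A0) / b -> mean_gap b f k.
Proof.
  intros Hb Hd Hc H0 Hl ->. exists l, (A b - A0). split; [exact Hl|]. split; [|reflexivity].
  apply (is_RInt_gen_antiderivative _ _ 0 A).
  - typeclasses eauto.
  - typeclasses eauto.
  - apply at_right_gt.
  - exact Hb.
  - exact Hd.
  - exact Hc.
  - exact H0.
  - intros P HP. exact (locally_singleton _ _ HP).
Qed.

Lemma mean_gap_const (b c : R) : 0 < b -> mean_gap b (fun _ => c) 0.
Proof.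
  intros Hb. apply (mean_gap_antiderivative b (fun t => c * t) _ 0 c).
  - exact Hb.
  - intros t _. auto_derive; [exact I | ring].
  - intros t _. apply continuous_const.
  - replace 0 with (c * 0) at 2 by ring. apply (continuous_at_right (fun t => c * t)).
    apply continuous_ex_derive. auto_derive. exact I.
  - apply is_exp_mean_const.
  - field. lra.
Qed.

Lemma mean_gap_plus (b : R) (f h : R -> R) (k j : R) :
  0 < b -> mean_gap b f k -> mean_gap b h j -> mean_gap b (fun t => f t + h t) (k + j).
Proof.
  intros Hb [l [m [Hl [Hm ->]]]] [l' [m' [Hl' [Hm' ->]]]].
  exists (l + l'), (m + m'). repeat split.
  - now apply is_exp_mean_plus.
  - exact (is_RInt_gen_plus _ _ _ _ Hm Hm').
  - field. lra.
Qed.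

Lemma mean_gap_scal (b c : R) (f : R -> R) (k : R) :
  0 < b -> mean_gap b f k -> mean_gap b (fun t => c * f t) (c * k).
Proof.
  intros Hb [l [m [Hl [Hm ->]]]]. exists (c * l), (c * m). repeat split.
  - now apply is_exp_mean_scal.
  - exact (is_RInt_gen_scal _ c _ Hm).
  - field. lra.
Qed.

Lemma mean_gap_minus (b : R) (f h : R -> R) (k j : R) :
  0 < b -> mean_gap b f k -> mean_gap b h j -> mean_gap b (fun t => f t - h t) (k - j).
Proof.
  intros Hb [l [m [Hl [Hm ->]]]] [l' [m' [Hl' [Hm' ->]]]].
  exists (l - l'), (m - m'). repeat split.
  - now apply is_exp_mean_minus.
  - exact (is_RInt_gen_minus _ _ _ _ Hm Hm').
  - field. lra.
Qed.

(** The gap integrates [f] against [exp (- t) - / b] on (0, b) and against [exp (- t)] beyond [b].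
    The first part is nonnegative, and the mass [eta] on [b, b + 1] makes the second strictly
    positive. *)
Lemma mean_gap_pos (b : R) (f : R -> R) (k : R) :
  0 < b ->
  (forall t, 0 < t -> continuous f t) ->
  (forall t, 0 < t < b -> 0 <= f t * (exp (- t) - / b)) ->
  (forall t, b < t -> 0 < f t) ->
  mean_gap b f k -> 0 < k.
Proof.
  intros Hb Hc H1 H2 [l [m [Hl [Hm ->]]]].
  pose (w := fun t => f t * exp (- t)).
  assert (Hcw : forall t, 0 < t -> continuous w t)
    by (intros; apply continuous_exp_weight; auto).
  pose (eta := RInt w b (b + 1)).
  assert (Heta : 0 < eta).
  { apply RInt_gt_0; [lra | |].
    - intros t Ht. apply Rmult_lt_0_compat; [apply H2; lra | apply exp_pos].
    - intros t Ht. apply Hcw. lra. }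
  apply Rlt_le_trans with eta; [exact Heta|].
  apply le_epsilon. intros eps Heps.
  assert (He2 : 0 < eps / 2) by lra.
  (* The tolerance for [m] carries a factor [b] because [m] enters the gap divided by [b]. *)
  assert (Heb : 0 < eps / 2 * b) by (apply Rmult_lt_0_compat; lra).
  apply is_exp_mean_int0 in Hl. fold w in Hl.
  rewrite is_int0_eps in Hl by exact Hcw.
  destruct (Hl _ He2) as [d1 [M [Hd1 HM]]].
  destruct (Hm (fun y => Rabs (y - m) < eps / 2 * b)) as [Q P [d Hd] HP HQP].
  { exists (mkposreal _ Heb). intros y Hy. exact Hy. }
  pose (D := Rmin b (Rmin d1 d)).
  assert (HD : 0 < D) by (repeat apply Rmin_glb_lt; try lra; apply cond_pos).
  assert (HDb : D <= b) by apply Rmin_l.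
  assert (HDd1 : D <= d1) by (eapply Rle_trans; [apply Rmin_r | apply Rmin_l]).
  assert (HDd : D <= d) by (eapply Rle_trans; [apply Rmin_r | apply Rmin_r]).
  pose (u := D / 2). pose (v := Rmax (b + 1) (M + 1)).
  assert (Hvb : b + 1 <= v) by apply Rmax_l. assert (HvM : M + 1 <= v) by apply Rmax_r.
  assert (Hu : 0 < u < D) by (unfold u; lra).
  specialize (HM u v ltac:(lra) ltac:(lra) ltac:(lra)).
  assert (exists y : R, is_RInt f u b y /\ Rabs (y - m) < eps / 2 * b) as [y [Hy Hym]].
  { apply (HQP u b); [|exact HP]. apply Hd; [|lra]. apply Rabs_lt_between'. simpl. lra. }
  apply Rabs_lt_between' in HM. apply Rabs_lt_between' in Hym.
  assert (Ew : forall s t, 0 < s -> 0 < t -> ex_RInt w s t)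
    by (intros; now apply ex_RInt_pos).
  assert (E1 : RInt w u v = RInt w u b + (eta + RInt w (b + 1) v)).
  { unfold eta.
    rewrite <- (RInt_Chasles w u b v), <- (RInt_Chasles w b (b + 1) v) by (apply Ew; lra).
    reflexivity. }
  assert (P1 : 0 <= RInt w (b + 1) v).
  { apply RInt_ge_0; [lra | apply Ew; lra |]. intros t Ht. left.
    apply Rmult_lt_0_compat; [apply H2; lra | apply exp_pos]. }
  assert (P2 : 0 <= RInt w u b - / b * y).
  { eapply (is_RInt_ge_0 (fun t => minus (w t) (scal (/ b) (f t))) u b); [lra | |].
    - apply (is_RInt_minus (V := R_NormedModule)).
      + apply (RInt_correct (V := R_CompleteNormedModule)), Ew; lra.
      + apply (is_RInt_scal (V := R_NormedModule)), Hy.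
    - intros t Ht. replace (minus (w t) (scal (/ b) (f t))) with (f t * (exp (- t) - / b)).
      + apply H1. lra.
      + unfold w, minus, plus, opp, scal; simpl. unfold mult; simpl. ring. }
  assert (P3 : m / b - y / b < eps / 2).
  { apply Rmult_lt_reg_r with b; [exact Hb|].
    replace ((m / b - y / b) * b) with (m - y) by (field; lra). lra. }
  unfold Rdiv in *. lra.
Qed.

Lemma MVT_pos (f df : R -> R) :
  (forall t, 0 < t -> is_derive f t (df t)) ->
  forall s t, 0 < s -> s < t -> exists z, s < z < t /\ f t - f s = df z * (t - s).
Proof.
  intros Hd s t Hs Hst. destruct (MVT_cor2 f df s t Hst) as [z [Ez Hz]].
  - intros q Hq. apply is_derive_Reals, Hd. lra.
  - now exists z.
Qed.

(** If [b <= 1], then [exp (- t) < / b] on all of (0, b), so the difference of densities changes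
    sign only at [b], exactly where [w t - w b] does; the gap of [w] would be positive. *)
Lemma mean_gap_zero_gt_1 (b : R) (w w' : R -> R) :
  0 < b ->
  (forall t, 0 < t -> is_derive w t (w' t)) -> (forall t, 0 < t -> 0 < w' t) ->
  mean_gap b w 0 -> 1 < b.
Proof.
  intros Hb Hw Hw' Gw.
  destruct (Rlt_or_le 1 b) as [H|H]; [exact H|]. exfalso.
  assert (Hinc := pos_derive_incr w w' Hw Hw').
  apply (Rlt_irrefl 0).
  apply (mean_gap_pos b (fun t => w t - w b)); [exact Hb | | | |].
  - intros t Ht. apply (continuous_minus (V := R_NormedModule)).
    + eapply is_derive_continuous, Hw, Ht.
    + apply continuous_const.
  - intros t Ht. specialize (Hinc t b ltac:(lra) ltac:(lra)).
    assert (exp (- t) < 1) by (rewrite <- exp_0; apply exp_increasing; lra).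
    assert (1 <= / b) by (rewrite <- Rinv_1; apply Rinv_le_contravar; lra). nra.
  - intros t Ht. specialize (Hinc b t ltac:(lra) ltac:(lra)). lra.
  - replace 0 with (0 - 0) by ring.
    apply (mean_gap_minus b w (fun _ => w b)); auto. now apply mean_gap_const.
Qed.

(* With [c = ln b], the weight [exp (- t) - / b] is positive before [c] and
   negative on (c, b); subtracting from [f] the combination of 1 and [w] that
   agrees with it at [c] and [b] leaves a function with the same sign pattern. *)
Lemma mean_gap_convex_pos (b : R) (f f' w w' r : R -> R) (k : R) :
  0 < b ->
  (forall t, 0 < t -> is_derive f t (f' t)) ->
  (forall t, 0 < t -> is_derive w t (w' t)) ->
  (forall t, 0 < t -> 0 < w' t) ->
  (forall t, 0 < t -> f' t = r t * w' t) ->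
  (forall s t, 0 < s -> s < t -> r s < r t) ->
  mean_gap b w 0 -> mean_gap b f k -> 0 < k.
Proof.
  intros Hb Hf Hw Hw' Hr Hincr Gw Gf.
  pose proof (mean_gap_zero_gt_1 b w w' Hb Hw Hw' Gw) as Hb1.
  pose (c := ln b).
  assert (Hec : exp (- c) = / b) by (unfold c; rewrite exp_Ropp, exp_ln; lra).
  assert (Hc0 : 0 < c) by (unfold c; rewrite <- ln_1; apply ln_increasing; lra).
  assert (Hcb : c < b).
  { apply exp_lt_inv. unfold c. rewrite exp_ln by lra. pose proof (exp_ineq1 b). lra. }
  assert (Hwinc := pos_derive_incr w w' Hw Hw').
  assert (Hwcb := Hwinc c b Hc0 Hcb).
  (* The slope of the chord of [f], seen as a function of [w], between [c] and [b]; [F] is the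
     deviation of [f] from this chord. *)
  pose (beta := (f b - f c) / (w b - w c)).
  pose (F := fun t => f t - (f c + beta * (w t - w c))).
  assert (HFd : forall t, 0 < t -> is_derive F t ((r t - beta) * w' t)).
  { intros t Ht. unfold F.
    replace ((r t - beta) * w' t) with (f' t - (0 + beta * (w' t - 0)))
      by (rewrite Hr by exact Ht; ring).
    apply (is_derive_minus (V := R_NormedModule)); [now apply Hf|].
    apply (is_derive_plus (V := R_NormedModule)).
    - apply (is_derive_const (V := R_NormedModule)).
    - apply (is_derive_scal (fun t => w t - w c)).
      apply (is_derive_minus (V := R_NormedModule)); [now apply Hw|].
      apply (is_derive_const (V := R_NormedModule)). }
  assert (HFc : F c = 0) by (unfold F; ring).
  assert (HFb : F b = 0) by (unfold F, beta; field; lra).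
  (* By Rolle, the slope [r] equals [beta] at some [xi] between [c] and [b]. As [r] increases, [F]
     decreases up to [xi] and increases after it. *)
  destruct (MVT_pos F _ HFd c b Hc0 Hcb) as [xi [Hxi Exi]]. rewrite HFc, HFb in Exi.
  assert (Hrxi : r xi = beta).
  { pose proof (Hw' xi ltac:(lra)).
    assert (H0 : (r xi - beta) * (w' xi * (b - c)) = 0) by lra.
    apply Rmult_integral in H0. destruct H0 as [H0|H0]; [lra|].
    assert (0 < w' xi * (b - c)) by (apply Rmult_lt_0_compat; lra). lra. }
  assert (Hdec : forall s t, 0 < s -> s < t -> t <= xi -> F t < F s).
  { intros s t Hs Hst Ht. destruct (MVT_pos F _ HFd s t Hs Hst) as [z [Hz Ez]].
    pose proof (Hw' z ltac:(lra)). pose proof (Hincr z xi ltac:(lra) ltac:(lra)).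
    assert (0 < (beta - r z) * w' z * (t - s))
      by (repeat apply Rmult_lt_0_compat; lra). lra. }
  assert (Hinc : forall s t, xi <= s -> s < t -> F s < F t).
  { intros s t Hs Hst. destruct (MVT_pos F _ HFd s t ltac:(lra) Hst) as [z [Hz Ez]].
    pose proof (Hw' z ltac:(lra)). pose proof (Hincr xi z ltac:(lra) ltac:(lra)).
    assert (0 < (r z - beta) * w' z * (t - s))
      by (repeat apply Rmult_lt_0_compat; lra). lra. }
  apply (mean_gap_pos b F); [exact Hb | | | |].
  - intros t Ht. eapply is_derive_continuous, HFd, Ht.
  - intros t Ht. rewrite <- Hec. destruct (Rtotal_order t c) as [Htc|[->|Htc]].
    + specialize (Hdec t c ltac:(lra) Htc ltac:(lra)).
      assert (exp (- c) < exp (- t)) by (apply exp_increasing; lra). nra.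
    + rewrite HFc. lra.
    + assert (exp (- t) < exp (- c)) by (apply exp_increasing; lra).
      assert (F t < 0); [|nra].
      destruct (Rle_or_lt t xi) as [Htx|Htx].
      * specialize (Hdec c t Hc0 Htc Htx). lra.
      * specialize (Hinc t b ltac:(lra) ltac:(lra)). lra.
  - intros t Ht. specialize (Hinc b t ltac:(lra) Ht). lra.
  (* Constants and [w] have zero gap, so [F] has the same gap as [f]. *)
  - replace k with (k - (0 + beta * (0 - 0))) by ring.
    apply mean_gap_minus; [exact Hb | exact Gf |].
    apply (mean_gap_plus b (fun _ => f c)); [exact Hb | now apply mean_gap_const |].
    apply (mean_gap_scal b beta (fun t => w t - w c)); [exact Hb|].
    apply (mean_gap_minus b w (fun _ => w c)); auto. now apply mean_gap_const.
Qed.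

(** The derivative is q^2 t^(q-1): the factor [q] removes the dependence on its sign. *)
Lemma scaled_Rpower_incr (q s t : R) :
  q <> 0 -> 0 < s -> s < t -> q * Rpower s q < q * Rpower t q.
Proof.
  intros Hq Hs Hst.
  apply (pos_derive_incr (fun y => q * Rpower y q) (fun y => q * (q * Rpower y (q - 1))));
    [| |exact Hs|exact Hst].
  - intros y Hy. apply is_derive_scal, is_derive_Rpower, Hy.
  - intros y _. pose proof (Rpower_pos y (q - 1)). rewrite <- Rmult_assoc.
    apply Rmult_lt_0_compat; [|assumption]. now apply Rsqr_pos_lt.
Qed.

Lemma scaled_Rpower_diff_pos (q x t : R) :
  q <> 0 -> 0 < x -> 0 < t -> 0 < q * (Rpower (x + t) q - Rpower t q).
Proof.
  intros Hq Hx Ht. pose proof (scaled_Rpower_incr q t (x + t) Hq Ht ltac:(lra)). lra.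
Qed.

Lemma is_exp_mean_ge0 (f : R -> R) (l : R) :
  (forall t, 0 < t -> continuous f t) -> (forall t, 0 < t -> 0 <= f t) ->
  is_exp_mean f l -> 0 <= l.
Proof.
  intros Hc Hp Hl.
  replace 0 with (RInt (fun t => f t * exp (- t)) 1 1) by (rewrite RInt_point; reflexivity).
  apply is_int0_ge_RInt; try lra.
  - intros; apply continuous_exp_weight; auto.
  - intros t Ht. apply Rmult_le_pos; [now apply Hp | left; apply exp_pos].
  - now apply is_exp_mean_int0.
Qed.

(** * The incomplete gamma function *)

Definition gamma_density (p t : R) : R := Rpower t p * exp (- t).

Lemma continuous_gamma_density (p t : R) : 0 < t -> continuous (gamma_density p) t.
Proof. intros Ht. apply continuous_exp_weight, continuous_Rpower, Ht. Qed.

Lemma RInt_shifted_gamma_density (x p u v : R) :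
  0 < x -> 0 < u -> 0 < v ->
  RInt (fun t => Rpower (x + t) p * exp (- t)) u v = exp x * RInt (gamma_density p) (x + u) (x + v).
Proof.
  intros Hx Hu Hv. apply is_RInt_unique.
  apply (is_RInt_ext (fun t => scal (exp x) (scal 1 (gamma_density p (1 * t + x))))).
  - intros t _. unfold gamma_density, scal; simpl. unfold mult; simpl.
    replace (1 * t + x) with (x + t) by ring.
    replace (exp (- t)) with (exp x * exp (- (x + t))) by (rewrite <- exp_plus; f_equal; ring).
    ring.
  - apply (is_RInt_scal (V := R_NormedModule)), (is_RInt_comp_lin (V := R_NormedModule)).
    replace (1 * u + x) with (x + u) by ring. replace (1 * v + x) with (x + v) by ring.
    apply (RInt_correct (V := R_CompleteNormedModule)), ex_RInt_pos; try lra.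
    intros; now apply continuous_gamma_density.
Qed.

(** The substitution t -> x + t turns the mean into an integral that is improper at [x], whereas
    [uGamma] starts at the point [x] itself. The missing piece from [x] to [x + u] vanishes with
    [u]. *)
Lemma is_RInt_gen_of_shifted_exp_mean (x p l : R) :
  0 < x ->
  is_exp_mean (fun t => Rpower (x + t) p) l ->
  is_RInt_gen (gamma_density p) (at_point x) (Rbar_locally p_infty) (exp (- x) * l).
Proof.
  intros Hx Hl P [eps HP]. pose (h := gamma_density p).
  (* The factor [exp x] produced by the substitution is absorbed into the tolerance. *)
  assert (He : 0 < exp x * (eps / 2)).
  { apply Rmult_lt_0_compat; [apply exp_pos | pose proof (cond_pos eps); lra]. }
  apply is_exp_mean_int0 in Hl.
  rewrite is_int0_eps in Hl.
  2:{ intros t Ht. apply continuous_exp_weight, continuous_Rpower_shift. lra. }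
  destruct (Hl _ He) as [d [M [Hd HM]]].
  assert (Hcont : continuous (fun s => RInt h x s) x).
  { apply (is_derive_continuous _ _ (h x)).
    apply (is_derive_RInt (V := R_NormedModule) h _ x x); [|now apply continuous_gamma_density].
    exists (mkposreal x Hx). intros s Hs. apply Rabs_lt_between' in Hs. simpl in Hs.
    apply (RInt_correct (V := R_CompleteNormedModule)), ex_RInt_pos; try lra.
    intros; now apply continuous_gamma_density. }
  apply continuous_at_right in Hcont. rewrite RInt_point in Hcont.
  assert (He2 : 0 < eps / 2) by (pose proof (cond_pos eps); lra).
  destruct (Hcont (fun y => Rabs (y - 0) < eps / 2)) as [d' Hd'].
  { exists (mkposreal _ He2). intros y Hy. exact Hy. }
  exists (fun u => u = x) (fun v => x + Rmax 1 M < v).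
  { reflexivity. }
  { apply infty_gt. }
  intros u v -> Hv. exists (RInt h x v). simpl.
  pose proof (Rmax_l 1 M). pose proof (Rmax_r 1 M).
  split.
  { apply (RInt_correct (V := R_CompleteNormedModule)), ex_RInt_pos; try lra.
    intros; now apply continuous_gamma_density. }
  apply HP. change (Rabs (RInt h x v - exp (- x) * l) < eps).
  pose (u := Rmin d d' / 2).
  assert (0 < Rmin d d') by (apply Rmin_glb_lt; [lra | apply cond_pos]).
  pose proof (Rmin_l d d'). pose proof (Rmin_r d d').
  assert (Hxu : Rabs (RInt h x (x + u) - 0) < eps / 2).
  { apply Hd'; [|unfold u; lra]. apply Rabs_lt_between'. unfold u. simpl. lra. }
  specialize (HM u (v - x) ltac:(unfold u; lra) ltac:(lra) ltac:(lra)).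
  rewrite RInt_shifted_gamma_density in HM by (unfold u; lra). fold h in HM.
  replace (x + (v - x)) with v in HM by ring.
  assert (E : RInt h x v = RInt h x (x + u) + RInt h (x + u) v).
  { symmetry. apply (RInt_Chasles (V := R_CompleteNormedModule));
      apply ex_RInt_pos; try (unfold u; lra); intros; now apply continuous_gamma_density. }
  replace (exp x * RInt h (x + u) v - l)
    with (exp x * (RInt h (x + u) v - exp (- x) * l)) in HM.
  2:{ rewrite Rmult_minus_distr_l, <- Rmult_assoc, <- exp_plus, Rplus_opp_r, exp_0. ring. }
  rewrite Rabs_mult, (Rabs_right (exp x)) in HM by (left; apply exp_pos).
  apply Rmult_lt_reg_l in HM; [|apply exp_pos].
  apply Rabs_lt_between' in Hxu. apply Rabs_lt_between' in HM.
  apply Rabs_lt_between'. rewrite E. lra.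
Qed.

Lemma is_RInt_gen_uGamma (a x : R) :
  0 < x ->
  is_RInt_gen (fun t => Rpower t (a - 1) * exp (- t)) (at_point x) (Rbar_locally p_infty)
    (uGamma a x).
Proof.
  intros Hx. destruct (ex_exp_mean_Rpower_shift x (a - 1)) as [l Hl]; [now left|].
  unfold uGamma. apply (RInt_gen_correct (V := R_CompleteNormedModule)).
  exists (exp (- x) * l). now apply is_RInt_gen_of_shifted_exp_mean.
Qed.

Lemma is_exp_mean_uGamma (a p x : R) :
  p = a - 1 -> 0 < x ->
  is_exp_mean (fun t => Rpower (x + t) p) (exp x * uGamma a x).
Proof.
  intros -> Hx. destruct (ex_exp_mean_Rpower_shift x (a - 1)) as [l Hl]; [now left|].
  assert (E : uGamma a x = exp (- x) * l).
  { exact (is_RInt_gen_unique (V := R_CompleteNormedModule) _ _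
             (is_RInt_gen_of_shifted_exp_mean x (a - 1) l Hx Hl)). }
  rewrite E, <- Rmult_assoc, <- exp_plus, Rplus_opp_r, exp_0, Rmult_1_l. exact Hl.
Qed.

Lemma exp_mul_expN (x y : R) : exp x * (y * exp (- x)) = y.
Proof.
  rewrite Rmult_comm, Rmult_assoc, <- exp_plus, Rplus_opp_l, exp_0. ring.
Qed.

Lemma uGamma_pos (a x : R) : 0 < x -> 0 < uGamma a x.
Proof.
  intros Hx. apply Rmult_lt_reg_l with (exp x); [apply exp_pos|]. rewrite Rmult_0_r.
  apply (is_exp_mean_pos (fun t => Rpower (x + t) (a - 1))).
  - intros t Ht. apply continuous_Rpower_shift. lra.
  - intros t _. apply Rpower_pos.
  - now apply is_exp_mean_uGamma.
Qed.

(** Integration by parts. It yields the closed forms at 1, 2 and 3 (at 1 the coefficient of the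
    second term is 0) and the asymptotics at infinity. *)
Lemma uGamma_rec (a x : R) :
  0 < x -> uGamma a x = Rpower x (a - 1) * exp (- x) + (a - 1) * uGamma (a - 1) x.
Proof.
  intros Hx. apply Rmult_eq_reg_l with (exp x); [|apply Rgt_not_eq, exp_pos].
  rewrite Rmult_plus_distr_l, exp_mul_expN.
  assert (H : exp x * uGamma a x - (a - 1) * (exp x * uGamma (a - 1) x) = Rpower x (a - 1));
    [|lra].
  apply (is_exp_mean_unique (fun t =>
    Rpower (x + t) (a - 1) - (a - 1) * Rpower (x + t) (a - 1 - 1))).
  - apply is_exp_mean_minus; [now apply is_exp_mean_uGamma|].
    apply is_exp_mean_scal. now apply is_exp_mean_uGamma.
  - apply is_exp_mean_by_parts; [lra|].
    replace (Rpower x (a - 1)) with (Rpower (x + 0) (a - 1)) by now rewrite Rplus_0_r.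
    apply (continuous_at_right (fun t => Rpower (x + t) (a - 1))).
    apply continuous_Rpower_shift. lra.
Qed.

Lemma uGamma_1 (x : R) : 0 < x -> uGamma 1 x = exp (- x).
Proof.
  intros Hx. rewrite uGamma_rec by exact Hx. replace (1 - 1) with 0 by ring.
  rewrite Rpower_O by exact Hx. ring.
Qed.

Lemma uGamma_2 (x : R) : 0 < x -> uGamma 2 x = exp (- x) * (1 + x).
Proof.
  intros Hx. rewrite uGamma_rec by exact Hx. replace (2 - 1) with 1 by ring.
  rewrite uGamma_1, Rpower_1 by exact Hx. ring.
Qed.

Lemma uGamma_3 (x : R) : 0 < x -> uGamma 3 x = exp (- x) * (2 + 2 * x + x ^ 2).
Proof.
  intros Hx. rewrite uGamma_rec by exact Hx. replace (3 - 1) with 2 by ring.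
  rewrite uGamma_2, (Rpower_INR_pow x 2 2) by (exact Hx || (simpl; ring)). ring.
Qed.

(** * Inequalities *)

Lemma b_pos (a : R) : 0 < b a.
Proof. unfold b. destruct (Req_EM_T a 1); apply exp_pos. Qed.

Lemma Rpower_b (a : R) : -1 < a -> a <> 1 -> Rpower (b a) (a - 1) = Gamma (a + 1).
Proof.
  intros Ha Ha1. unfold b. destruct (Req_EM_T a 1) as [E|_]; [lra|].
  rewrite Rpower_mult. replace (1 / (a - 1) * (a - 1)) with 1 by (field; lra).
  apply Rpower_1, Gamma_pos. lra.
Qed.

(** The defining property of [b a], in the form E U_b^(a-1) = E T^(a-1). *)
Lemma Rpower_b_succ (a : R) : 0 < a -> a <> 1 -> Rpower (b a) a = b a * (a * Gamma a).
Proof.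
  intros Ha Ha1. rewrite <- Gamma_succ, <- Rpower_b by lra.
  symmetry. apply Rpower_pred, b_pos.
Qed.

Lemma mean_gap_Rpower_shift (a c x : R) :
  a <> 0 -> 0 < c -> 0 < x ->
  mean_gap c (fun t => Rpower (x + t) (a - 1))
    (exp x * uGamma a x - (Rpower (x + c) a - Rpower x a) / (a * c)).
Proof.
  intros Ha Hc Hx.
  apply (mean_gap_antiderivative c (fun t => / a * Rpower (x + t) a) _
           (/ a * Rpower x a) (exp x * uGamma a x)).
  - exact Hc.
  - intros t Ht. replace (Rpower (x + t) (a - 1)) with (/ a * (a * Rpower (x + t) (a - 1)))
      by (field; exact Ha).
    apply is_derive_scal, is_derive_Rpower_shift. lra.
  - intros t Ht. apply continuous_Rpower_shift. lra.
  - replace (Rpower x a) with (Rpower (x + 0) a) by now rewrite Rplus_0_r.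
    apply (continuous_at_right (fun t => / a * Rpower (x + t) a)).
    apply (continuous_scal_r (V := R_NormedModule) (/ a)).
    apply continuous_Rpower_shift. lra.
  - now apply is_exp_mean_uGamma.
  - field. lra.
Qed.

Lemma mean_gap_Rpower (a c : R) :
  0 < a -> 0 < c ->
  mean_gap c (fun t => Rpower t (a - 1)) (Gamma a - Rpower c (a - 1) / a).
Proof.
  intros Ha Hc.
  apply (mean_gap_antiderivative c (fun t => / a * Rpower t a) _ (/ a * 0) (Gamma a)).
  - exact Hc.
  - intros t Ht. replace (Rpower t (a - 1)) with (/ a * (a * Rpower t (a - 1)))
      by (field; lra).
    apply is_derive_scal, is_derive_Rpower. lra.
  - intros t Ht. now apply continuous_Rpower.
  - eapply filterlim_comp; [exact (filterlim_Rpower_0 a Ha)|].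
    apply (filterlim_scal_r (V := R_NormedModule) (/ a)).
  - now apply is_exp_mean_Gamma.
  - rewrite <- (Rpower_pred c a Hc). field. lra.
Qed.

Lemma mean_gap_id : mean_gap 2 (fun t => t) 0.
Proof.
  apply (mean_gap_antiderivative 2 (fun t => t ^ 2 / 2) _ (0 ^ 2 / 2) 1).
  - lra.
  - intros t _. auto_derive; [exact I | field].
  - intros t _. apply continuous_id.
  - apply (continuous_at_right (fun t => t ^ 2 / 2)).
    apply continuous_ex_derive. auto_derive. exact I.
  - apply is_exp_mean_id.
  - field.
Qed.

Lemma exp_mul_G (a x : R) :
  a <> -1 -> a <> 0 ->
  exp x * G a x = (Rpower (x + b a) a - Rpower x a) / (a * b a).
Proof.
  intros H1 H0. unfold G.
  destruct (Req_EM_T a (-1)) as [E|_]; [contradiction|].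
  destruct (Req_EM_T a 0) as [E|_]; [contradiction|].
  apply exp_mul_expN.
Qed.

Lemma exp_mul_g (a x : R) :
  exp x * g a x = (Rpower (x + 2) a - Rpower x a - Rpower 2 a) / (2 * a) + Gamma a.
Proof. apply exp_mul_expN. Qed.

Lemma shift_ratio_decr (x s t : R) :
  0 < x -> 0 < s -> s < t -> (x + t) / t < (x + s) / s.
Proof.
  intros Hx Hs Hst.
  replace ((x + t) / t) with (x * / t + 1) by (field; lra).
  replace ((x + s) / s) with (x * / s + 1) by (field; lra).
  apply Rplus_lt_compat_r, Rmult_lt_compat_l; [exact Hx|].
  apply Rinv_lt_contravar; [apply Rmult_lt_0_compat; lra | exact Hst].
Qed.

(** Take w = t^(a-1)/(a-1) and f = (2-a)/(a-1) (x+t)^(a-1); then f'/w' = (2-a) ((x+t)/t)^(a-2) is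
    increasing. The prefactor lets one statement cover (0, 1), (1, 2) and (2, oo). *)
Lemma uGamma_G_compare (a x : R) :
  0 < a -> a <> 1 -> a <> 2 -> 0 < x -> 0 < (2 - a) / (a - 1) * (uGamma a x - G a x).
Proof.
  intros Ha Ha1 Ha2 Hx.
  assert (Hp : a - 1 <> 0) by lra. pose proof (b_pos a) as Hb.
  apply Rmult_lt_reg_l with (exp x); [apply exp_pos|]. rewrite Rmult_0_r.
  replace (exp x * ((2 - a) / (a - 1) * (uGamma a x - G a x)))
    with ((2 - a) / (a - 1) * (exp x * uGamma a x - exp x * G a x)) by ring.
  rewrite exp_mul_G by lra.
  apply (mean_gap_convex_pos (b a)
    (fun t => (2 - a) / (a - 1) * Rpower (x + t) (a - 1))
    (fun t => (2 - a) / (a - 1) * ((a - 1) * Rpower (x + t) (a - 1 - 1)))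
    (fun t => / (a - 1) * Rpower t (a - 1))
    (fun t => / (a - 1) * ((a - 1) * Rpower t (a - 1 - 1)))
    (fun t => (2 - a) * Rpower ((x + t) / t) (a - 1 - 1))).
  - exact Hb.
  - intros t Ht. apply is_derive_scal, is_derive_Rpower_shift. lra.
  - intros t Ht. apply is_derive_scal, is_derive_Rpower, Ht.
  - intros t _. rewrite <- Rmult_assoc, Rinv_l, Rmult_1_l by exact Hp. apply Rpower_pos.
  - intros t Ht.
    replace (Rpower (x + t) (a - 1 - 1))
      with (Rpower ((x + t) / t) (a - 1 - 1) * Rpower t (a - 1 - 1)).
    + field. exact Hp.
    + rewrite Rpower_mult_distr; [|apply Rdiv_lt_0_compat; lra | exact Ht].
      f_equal. field. lra.
  (* Two reversals cancel: (x+t)/t decreases in t, and the coefficient is 2 - a rather than a -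
     2. *)
  - intros s t Hs Hst.
    pose proof (scaled_Rpower_incr (a - 1 - 1) ((x + t) / t) ((x + s) / s) ltac:(lra)
      ltac:(apply Rdiv_lt_0_compat; lra) (shift_ratio_decr x s t Hx Hs Hst)). lra.
  (* The gap of [w] vanishes by the choice of [b a]. *)
  - replace 0 with (/ (a - 1) * (Gamma a - Rpower (b a) (a - 1) / a)).
    + apply mean_gap_scal; [exact Hb|]. now apply mean_gap_Rpower.
    + rewrite Rpower_b, Gamma_succ by lra. field. lra.
  - apply mean_gap_scal; [exact Hb|]. apply mean_gap_Rpower_shift; lra.
Qed.

(** For [c <= 1] the exponential density lies below the uniform one on (0, c) and above it
    afterwards, while (x+t)^(a-1) decreases; a single crossing decides the sign. *)
Lemma mean_gap_shift_nonpos (a c x k : R) :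
  a < 1 -> 0 < c <= 1 -> 0 < x ->
  mean_gap c (fun t => Rpower (x + t) (a - 1)) k -> k < 0.
Proof.
  intros Ha Hc Hx Hk. assert (0 < 0 - k); [|lra].
  apply (mean_gap_pos c (fun t => Rpower (x + c) (a - 1) - Rpower (x + t) (a - 1))).
  - lra.
  - intros t Ht. apply (continuous_minus (V := R_NormedModule)).
    + apply continuous_const.
    + apply continuous_Rpower_shift. lra.
  - intros t Ht.
    pose proof (Rpower_base_decr (x + t) (x + c) (a - 1) ltac:(lra) ltac:(lra)).
    pose proof (exp_increasing (- t) 0 ltac:(lra)) as He. rewrite exp_0 in He.
    assert (1 <= / c) by (rewrite <- Rinv_1; apply Rinv_le_contravar; lra). nra.
  - intros t Ht.
    pose proof (Rpower_base_decr (x + c) (x + t) (a - 1) ltac:(lra) ltac:(lra)). lra.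
  - apply (mean_gap_minus c (fun _ => Rpower (x + c) (a - 1))); [lra | | exact Hk].
    apply mean_gap_const. lra.
Qed.

(** For negative [a], t^a lies above its tangent 1 + a (t - 1) at 1, whose exponential mean is 1
    because E T = 1. *)
Lemma Gamma_ge_1 (a : R) : -1 < a < 0 -> 1 <= Gamma (a + 1).
Proof.
  intros Ha. assert (H : 0 <= Gamma (a + 1) - (1 + a * (1 - 1))); [|lra].
  apply (is_exp_mean_ge0 (fun t => Rpower t a - (1 + a * (t - 1)))).
  - intros t Ht. apply (continuous_minus (V := R_NormedModule)).
    + now apply continuous_Rpower.
    + apply continuous_ex_derive. auto_derive. exact I.
  - intros t Ht.
    assert (H1 : 1 + a * ln t <= Rpower t a) by apply exp_ineq1_le.
    assert (H2 : ln t <= t - 1).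
    { pose proof (exp_ineq1_le (ln t)) as H. rewrite exp_ln in H by exact Ht. lra. }
    nra.
  - apply is_exp_mean_minus; [apply is_exp_mean_Gamma; lra|].
    apply (is_exp_mean_plus (fun _ => 1)); [apply is_exp_mean_1|].
    apply (is_exp_mean_scal a (fun t => t - 1)).
    apply (is_exp_mean_minus (fun t => t)); [apply is_exp_mean_id | apply is_exp_mean_1].
Qed.

Lemma b_le_1 (a : R) : -1 < a < 0 -> b a <= 1.
Proof.
  intros Ha. unfold b. destruct (Req_EM_T a 1) as [E|_]; [lra|].
  pose proof (Gamma_ge_1 a Ha) as H. unfold Rpower.
  assert (0 <= ln (Gamma (a + 1))) by (rewrite <- ln_1; apply ln_le; lra).
  assert (1 / (a - 1) < 0).
  { replace (1 / (a - 1)) with (- / (1 - a)) by (field; lra).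
    assert (0 < / (1 - a)) by (apply Rinv_0_lt_compat; lra). lra. }
  apply Rle_trans with (exp 0); [|rewrite exp_0; lra].
  apply exp_le_mono. nra.
Qed.

Lemma uGamma_lt_G_nonpos (a x : R) :
  -1 <= a <= 0 -> 0 < x -> uGamma a x < G a x.
Proof.
  intros Ha Hx. apply Rmult_lt_reg_l with (exp x); [apply exp_pos|].
  destruct (Req_dec a (-1)) as [->|H1]; [|destruct (Req_dec a 0) as [->|H0]].
  (* Here the uniform law degenerates to the point 0: 1/x^2 is the value of (x+t)^(-2) at t = 0. *)
  - unfold G. destruct (Req_EM_T (-1) (-1)) as [_|E]; [|lra]. rewrite exp_mul_expN.
    replace (/ x ^ 2) with (Rpower x (-1 - 1)).
    2:{ replace (-1 - 1) with (- (2)) by ring.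
        rewrite Rpower_Ropp, (Rpower_INR_pow x 2 2) by (exact Hx || (simpl; ring)). reflexivity. }
    apply (is_exp_mean_lt (fun t => Rpower (x + t) (-1 - 1)) (fun _ => Rpower x (-1 - 1))).
    + intros t Ht. apply continuous_Rpower_shift. lra.
    + intros t Ht. apply continuous_const.
    + intros t Ht. apply Rpower_base_decr; lra.
    + now apply is_exp_mean_uGamma.
    + apply is_exp_mean_const.
  - unfold G. destruct (Req_EM_T 0 (-1)) as [E|_]; [lra|].
    destruct (Req_EM_T 0 0) as [_|E]; [|lra].
    rewrite (Rmult_comm (exp (- x))), exp_mul_expN.
    (* At [a = 0] the logarithm is the mean of 1/(x+u) over [0, 1]. *)
    apply Rminus_lt. apply (mean_gap_shift_nonpos 0 1 x); try lra.
    apply (mean_gap_antiderivative 1 (fun t => ln (x + t)) _ (ln (x + 0)) (exp x * uGamma 0 x)).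
    + lra.
    + intros t Ht. auto_derive; [lra|].
      rewrite <- (Rpower_1 (x + t)) at 1 by lra.
      replace (0 - 1) with (- (1)) by ring. rewrite Rpower_Ropp. ring.
    + intros t Ht. apply continuous_Rpower_shift. lra.
    + apply (continuous_at_right (fun t => ln (x + t))).
      apply continuous_ex_derive. auto_derive. lra.
    + now apply is_exp_mean_uGamma.
    + rewrite Rplus_0_r, ln_div by lra. field.
  - rewrite exp_mul_G by assumption. apply Rminus_lt.
    apply (mean_gap_shift_nonpos a (b a) x).
    + lra.
    + split; [apply b_pos | apply b_le_1; lra].
    + exact Hx.
    + apply mean_gap_Rpower_shift; try lra. apply b_pos.
Qed.

(** With w = t, convexity of f = (a-3) ((x+t)^(a-1) - t^(a-1)) holds because f'' is (a-1)(a-2) > 0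
    times (a-3) ((x+t)^(a-3) - t^(a-3)), which is positive for either sign of a - 3. *)
Lemma uGamma_g_compare (a x : R) :
  2 < a -> a <> 3 -> 0 < x -> 0 < (a - 3) * (uGamma a x - g a x).
Proof.
  intros Ha Ha3 Hx. apply Rmult_lt_reg_l with (exp x); [apply exp_pos|]. rewrite Rmult_0_r.
  pose (df := fun t => (a - 3) * ((a - 1) * Rpower (x + t) (a - 1 - 1)
                                  - (a - 1) * Rpower t (a - 1 - 1))).
  apply (mean_gap_convex_pos 2
    (fun t => (a - 3) * (Rpower (x + t) (a - 1) - Rpower t (a - 1)))
    df (fun t => t) (fun _ => 1) df).
  - lra.
  - intros t Ht. apply is_derive_scal.
    apply (is_derive_minus (V := R_NormedModule)).
    + apply is_derive_Rpower_shift. lra.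
    + apply is_derive_Rpower, Ht.
  - intros t _. apply (is_derive_id (K := R_AbsRing)).
  - intros t _. lra.
  - intros t _. ring.
  - apply (pos_derive_incr df (fun t => (a - 3) *
      ((a - 1) * ((a - 1 - 1) * Rpower (x + t) (a - 1 - 1 - 1))
       - (a - 1) * ((a - 1 - 1) * Rpower t (a - 1 - 1 - 1))))).
    + intros t Ht. apply is_derive_scal.
      apply (is_derive_minus (V := R_NormedModule)); apply is_derive_scal.
      * apply is_derive_Rpower_shift. lra.
      * apply is_derive_Rpower, Ht.
    + intros t Ht.
      pose proof (scaled_Rpower_diff_pos (a - 1 - 1 - 1) x t ltac:(lra) Hx Ht) as H.
      assert (H2 : 0 < (a - 1) * (a - 1 - 1)) by (apply Rmult_lt_0_compat; lra).
      pose proof (Rmult_lt_0_compat _ _ H2 H). lra.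
  - apply mean_gap_id.
  - replace (exp x * ((a - 3) * (uGamma a x - g a x))) with ((a - 3) *
      ((exp x * uGamma a x - (Rpower (x + 2) a - Rpower x a) / (a * 2))
       - (Gamma a - Rpower 2 (a - 1) / a))).
    + apply mean_gap_scal; [lra|]. apply mean_gap_minus; [lra | |].
      * apply mean_gap_Rpower_shift; lra.
      * apply mean_gap_Rpower; lra.
    + replace (exp x * ((a - 3) * (uGamma a x - g a x)))
        with ((a - 3) * (exp x * uGamma a x - exp x * g a x)) by ring.
      rewrite exp_mul_g, <- (Rpower_pred 2 a) by lra. field. lra.
Qed.

(** Since E T = E U_2, convexity of (a-2) t^(a-1) compares E T^(a-1) with E U_2^(a-1), that is, the
    powers a - 1 of [b a] and of 2; as a - 1 > 0, the bases compare alike. *)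
Lemma b_2_compare (a : R) : 1 < a -> a <> 2 -> 0 < (a - 2) * (b a - 2).
Proof.
  intros Ha Ha2.
  assert (H : 0 < (a - 2) * (Gamma a - Rpower 2 (a - 1) / a)).
  { apply (mean_gap_convex_pos 2
      (fun t => (a - 2) * Rpower t (a - 1))
      (fun t => (a - 2) * ((a - 1) * Rpower t (a - 1 - 1)))
      (fun t => t) (fun _ => 1)
      (fun t => (a - 2) * ((a - 1) * Rpower t (a - 1 - 1)))).
    - lra.
    - intros t Ht. apply is_derive_scal, is_derive_Rpower, Ht.
    - intros t _. apply (is_derive_id (K := R_AbsRing)).
    - intros t _. lra.
    - intros t _. ring.
    - intros s t Hs Hst.
      pose proof (scaled_Rpower_incr (a - 1 - 1) s t ltac:(lra) Hs Hst). nra.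
    - apply mean_gap_id.
    - apply mean_gap_scal; [lra|]. apply mean_gap_Rpower; lra. }
  assert (H' : 0 < (a - 2) * (Rpower (b a) (a - 1) - Rpower 2 (a - 1))).
  { rewrite Rpower_b, Gamma_succ by lra.
    replace (a * Gamma a - Rpower 2 (a - 1)) with (a * (Gamma a - Rpower 2 (a - 1) / a))
      by (field; lra). nra. }
  pose proof (b_pos a) as Hb.
  destruct (Rtotal_order (b a) 2) as [Hlt|[E|Hgt]].
  - pose proof (Rlt_Rpower_l (b a) 2 (a - 1) ltac:(lra) ltac:(lra)). nra.
  - rewrite E in H'. lra.
  - pose proof (Rlt_Rpower_l 2 (b a) (a - 1) ltac:(lra) ltac:(lra)). nra.
Qed.

(* [S t] is the mean over [0, t] of the monotone function
   [(x + u)^(a-1) - u^(a-1)]. *)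
Lemma mean_increment_incr (a x : R) :
  1 < a -> a <> 2 -> 0 < x ->
  let S t := (Rpower (x + t) a - Rpower x a - Rpower t a) / (a * t) in
  forall s t, 0 < s -> s < t -> (a - 2) * S s < (a - 2) * S t.
Proof.
  intros Ha Ha2 Hx S.
  pose (A := fun t => / a * (Rpower (x + t) a - Rpower t a - Rpower x a)).
  pose (psi := fun t => Rpower (x + t) (a - 1) - Rpower t (a - 1)).
  pose (dpsi := fun t => (a - 1) * Rpower (x + t) (a - 1 - 1)
                         - (a - 1) * Rpower t (a - 1 - 1)).
  assert (HA : forall t, 0 < t -> is_derive A t (psi t)).
  { intros t Ht. unfold A, psi.
    replace (Rpower (x + t) (a - 1) - Rpower t (a - 1))
      with (/ a * (a * Rpower (x + t) (a - 1) - a * Rpower t (a - 1) - 0)) by (field; lra).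
    apply is_derive_scal.
    apply (is_derive_minus (V := R_NormedModule));
      [apply (is_derive_minus (V := R_NormedModule))|].
    - apply is_derive_Rpower_shift. lra.
    - apply is_derive_Rpower, Ht.
    - apply (is_derive_const (V := R_NormedModule)). }
  assert (Hpsi : forall t, 0 < t -> is_derive psi t (dpsi t)).
  { intros t Ht. apply (is_derive_minus (V := R_NormedModule)).
    - apply is_derive_Rpower_shift. lra.
    - apply is_derive_Rpower, Ht. }
  assert (Hdpsi : forall t, 0 < t -> 0 < (a - 2) * dpsi t).
  { intros t Ht. pose proof (scaled_Rpower_diff_pos (a - 1 - 1) x t ltac:(lra) Hx Ht).
    unfold dpsi. nra. }
  (* Since [S t] is [A t / t], [N] is the numerator of the derivative of (a-2) S over t^2. *)
  pose (N := fun t => (a - 2) * (t * psi t - A t)).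
  assert (HN : forall t, 0 < t -> is_derive N t ((a - 2) * (t * dpsi t))).
  { intros t Ht. apply is_derive_scal.
    replace (t * dpsi t) with (1 * psi t + t * dpsi t - psi t) by ring.
    apply (is_derive_minus (V := R_NormedModule)); [|now apply HA].
    apply (is_derive_mult (fun t => t) psi); [apply (is_derive_id (K := R_AbsRing)) | | ].
    - now apply Hpsi.
    - intros; apply Rmult_comm. }
  assert (HNinc := pos_derive_incr N _ HN).
  assert (HN0 : filterlim N (at_right 0) (locally 0)).
  (* The powers of [t] itself are collected into one term t^a, which tends to 0 from the right; all
     else is continuous at 0. *)
  { apply (filterlim_ext_loc (fun t => (a - 2) *
      (t * Rpower (x + t) (a - 1) - / a * (Rpower (x + t) a - Rpower x a)
       + (/ a - 1) * Rpower t a))).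
    { eapply filter_imp; [|exact (at_right_gt 0)]. intros t Ht.
      unfold N, psi, A. rewrite <- (Rpower_pred t a Ht). ring. }
    replace 0 with ((a - 2) *
      (0 * Rpower (x + 0) (a - 1) - / a * (Rpower (x + 0) a - Rpower x a) + (/ a - 1) * 0))
      at 2 by (rewrite Rplus_0_r; ring).
    eapply filterlim_comp; [|apply (filterlim_scal_r (V := R_NormedModule) (a - 2))].
    eapply filterlim_comp_2; [| |apply (filterlim_plus (V := R_NormedModule))].
    - apply (continuous_at_right (fun t => t * Rpower (x + t) (a - 1)
                                   - / a * (Rpower (x + t) a - Rpower x a))).
      apply continuous_ex_derive.
      unfold Rpower. auto_derive. lra.
    - eapply filterlim_comp; [exact (filterlim_Rpower_0 a ltac:(lra))|].
      apply (filterlim_scal_r (V := R_NormedModule)). }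
  assert (HNpos : forall t, 0 < t -> 0 < N t).
  (* The limit 0 only gives [0 <= N (t / 2)]; strict growth from [t / 2] to [t] then makes [N t]
     positive. *)
  { intros t Ht. apply Rle_lt_trans with (N (t / 2)).
    - apply (filterlim_le (F := at_right 0) N (fun _ => N (t / 2)) 0 (N (t / 2)));
        [|exact HN0 | apply filterlim_const].
      eapply filter_imp;
        [|exact (filter_and _ _ (at_right_gt 0) (at_right_lt 0 (t / 2) ltac:(lra)))].
      intros u [Hu0 Hut]. left. apply HNinc; try lra.
      intros r Hr. specialize (Hdpsi r Hr). nra.
    - apply HNinc; try lra. intros r Hr. specialize (Hdpsi r Hr). nra. }
  apply (pos_derive_incr (fun t => (a - 2) * S t) (fun t => N t / t ^ 2)).
  - intros t Ht.
    replace (N t / t ^ 2) with ((a - 2) * (psi t * / t + A t * (- 1 / t ^ 2)))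
      by (unfold N; field; lra).
    apply is_derive_scal.
    apply (is_derive_ext_loc (fun t => A t * / t)).
    { exists (mkposreal t Ht). intros s Hs. apply Rabs_lt_between' in Hs. simpl in Hs.
      assert (E : A s * / s = S s) by (unfold A, S; field; lra). exact E. }
    apply (is_derive_mult A (fun t => / t)); [now apply HA | |].
    + auto_derive; [lra | field; lra].
    + intros; apply Rmult_comm.
  - intros t Ht. apply Rdiv_lt_0_compat; [now apply HNpos | nra].
Qed.

(** * Exactness *)

Lemma filterlim_limit_eq (F : (R -> Prop) -> Prop) (f : R -> R) (l m : R) :
  l = m -> filterlim f F (locally l) -> filterlim f F (locally m).
Proof. now intros ->. Qed.

Lemma filterlim_Rplus (F : (R -> Prop) -> Prop) (f h : R -> R) (l m : R) :
  Filter F -> filterlim f F (locally l) -> filterlim h F (locally m) ->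
  filterlim (fun x => f x + h x) F (locally (l + m)).
Proof.
  intros FF Hf Hh. eapply filterlim_comp_2; [exact Hf | exact Hh |].
  apply (filterlim_plus (V := R_NormedModule)).
Qed.

Lemma filterlim_Rmult (F : (R -> Prop) -> Prop) (f h : R -> R) (l m : R) :
  Filter F -> filterlim f F (locally l) -> filterlim h F (locally m) ->
  filterlim (fun x => f x * h x) F (locally (l * m)).
Proof.
  intros FF Hf Hh. eapply filterlim_comp_2; [exact Hf | exact Hh |].
  apply (filterlim_mult (K := R_AbsRing)).
Qed.

Lemma filterlim_ratio_1 (F : (R -> Prop) -> Prop) (f h : R -> R) (l : R) :
  Filter F -> l <> 0 -> filterlim f F (locally l) -> filterlim h F (locally l) ->
  filterlim (fun x => f x / h x) F (locally 1).
Proof.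
  intros FF Hl Hf Hh. replace 1 with (l * / l) by (field; exact Hl).
  apply filterlim_Rmult; [exact FF | exact Hf |].
  eapply filterlim_comp; [exact Hh|].
  apply (filterlim_Rbar_inv (Finite l)). intros E. injection E. exact Hl.
Qed.

(** * Behaviour at 0 *)

Lemma uGamma_eps (a x eps : R) :
  0 < x -> 0 < eps ->
  exists M, forall v, M < v ->
    Rabs (RInt (fun t => Rpower t (a - 1) * exp (- t)) x v - uGamma a x) < eps.
Proof.
  intros Hx Heps.
  destruct (is_RInt_gen_uGamma a x Hx (fun y => Rabs (y - uGamma a x) < eps))
    as [Q P HQ [M HM] HQP].
  { exists (mkposreal eps Heps). intros y Hy. exact Hy. }
  exists M. intros v Hv. destruct (HQP x v HQ (HM v Hv)) as [y [Hy1 Hy2]].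
  simpl in Hy1. now rewrite (is_RInt_unique _ _ _ _ Hy1).
Qed.

(** For [x] near 0 and [v] large, the integral from [x] to [v] is within [eps / 2] of both [Gamma a]
    and [uGamma a x]. *)
Lemma uGamma_lim_0 (a : R) :
  0 < a -> filterlim (uGamma a) (at_right 0) (locally (Gamma a)).
Proof.
  intros Ha P [eps HP].
  assert (He : 0 < eps / 2) by (pose proof (cond_pos eps); lra).
  pose proof (is_exp_mean_Gamma a (a - 1) eq_refl Ha) as Hl.
  apply is_exp_mean_int0 in Hl.
  rewrite is_int0_eps in Hl by exact (continuous_gamma_density (a - 1)).
  destruct (Hl _ He) as [d [M [Hd HM]]].
  exists (mkposreal d Hd). intros x Hxd Hx.
  apply Rabs_lt_between' in Hxd. simpl in Hxd.
  destruct (uGamma_eps a x _ Hx He) as [M' HM'].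
  pose (v := Rmax (Rmax M M') 0 + 1).
  pose proof (Rmax_l (Rmax M M') 0). pose proof (Rmax_r (Rmax M M') 0).
  pose proof (Rmax_l M M'). pose proof (Rmax_r M M').
  specialize (HM x v ltac:(lra) ltac:(unfold v; lra) ltac:(unfold v; lra)).
  specialize (HM' v ltac:(unfold v; lra)).
  apply HP. change (Rabs (uGamma a x - Gamma a) < eps).
  apply Rabs_lt_between' in HM. apply Rabs_lt_between' in HM'.
  apply Rabs_lt_between'. lra.
Qed.

(** The common shape of [G] (with [k = 0]) and [g] (with [c = 2]). The term x^a is split off because
    only its right limit at 0 is available. *)
Lemma secant_form_lim_0 (a c k : R) :
  0 < a -> 0 < c ->
  filterlim (fun x => ((Rpower (x + c) a - Rpower x a) / (a * c) + k) * exp (- x))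
    (at_right 0) (locally (Rpower c a / (a * c) + k)).
Proof.
  intros Ha Hc.
  apply (filterlim_ext (fun x => (Rpower (x + c) a / (a * c) + k) * exp (- x)
                                 + Rpower x a * (- / (a * c) * exp (- x)))).
  { intros x. field. lra. }
  replace (Rpower c a / (a * c) + k)
    with ((Rpower (0 + c) a / (a * c) + k) * exp (- 0) + 0 * (- / (a * c) * exp (- 0)))
    by (rewrite Rplus_0_l, Ropp_0, exp_0; ring).
  apply filterlim_Rplus; [typeclasses eauto | | apply filterlim_Rmult; [typeclasses eauto | |]].
  - apply (continuous_at_right (fun x => (Rpower (x + c) a / (a * c) + k) * exp (- x))).
    apply continuous_ex_derive. unfold Rpower. auto_derive. lra.
  - now apply filterlim_Rpower_0.
  - apply (continuous_at_right (fun x => - / (a * c) * exp (- x))).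
    apply continuous_ex_derive. auto_derive. exact I.
Qed.

Lemma G_lim_0 (a : R) : 0 < a -> filterlim (G a) (at_right 0) (locally (Gamma a)).
Proof.
  intros Ha. pose proof (b_pos a) as Hb.
  replace (Gamma a) with (Rpower (b a) a / (a * b a) + 0).
  - eapply filterlim_ext; [|exact (secant_form_lim_0 a (b a) 0 Ha Hb)].
    intros x. apply Rmult_eq_reg_l with (exp x); [|apply Rgt_not_eq, exp_pos].
    rewrite exp_mul_G, exp_mul_expN by lra. ring.
  - destruct (Req_dec a 1) as [->|H1].
    (* At [a = 1] the quotient is 1 whatever the positive value of [b 1]. *)
    + rewrite Gamma_1, Rpower_1 by exact Hb. field. lra.
    + rewrite Rpower_b_succ by assumption. field. lra.
Qed.

Lemma g_lim_0 (a : R) : 0 < a -> filterlim (g a) (at_right 0) (locally (Gamma a)).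
Proof.
  intros Ha.
  replace (Gamma a) with (Rpower 2 a / (a * 2) + (Gamma a - Rpower 2 a / (2 * a)))
    by (field; lra).
  eapply filterlim_ext;
    [|exact (secant_form_lim_0 a 2 (Gamma a - Rpower 2 a / (2 * a)) Ha ltac:(lra))].
  intros x. unfold g. f_equal. field. lra.
Qed.

Lemma exact_at_0_of_lim (a : R) (B : R -> R) :
  0 < a -> filterlim B (at_right 0) (locally (Gamma a)) -> exact_at_0 a B.
Proof.
  intros Ha HB. apply (filterlim_ratio_1 _ _ _ (Gamma a)).
  - typeclasses eauto.
  - apply Rgt_not_eq, Gamma_pos, Ha.
  - exact HB.
  - now apply uGamma_lim_0.
Qed.

(** On (x, 1) the density is at least 1/t - 1, because e^(-t) >= 1 - t. *)
Lemma uGamma_0_lower (x : R) : 0 < x < 1 -> - ln x - 1 <= uGamma 0 x.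
Proof.
  intros Hx. apply le_epsilon. intros eps Heps.
  destruct (uGamma_eps 0 x eps ltac:(lra) Heps) as [M HM].
  pose (v := Rmax 1 M + 1). pose proof (Rmax_l 1 M). pose proof (Rmax_r 1 M).
  specialize (HM v ltac:(unfold v; lra)). apply Rabs_lt_between' in HM.
  pose (h := fun t => Rpower t (0 - 1) * exp (- t)). fold h in HM.
  assert (Hc : forall t, 0 < t -> continuous h t) by exact (continuous_gamma_density (0 - 1)).
  assert (H1 : RInt h x 1 <= RInt h x v).
  { apply RInt_mono_bounds; unfold v; try lra; [exact Hc|].
    intros t _. left. apply Rmult_lt_0_compat; [apply Rpower_pos | apply exp_pos]. }
  assert (H2 : (ln 1 - 1) - (ln x - x) <= RInt h x 1); [|rewrite ln_1 in H2; lra].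
  apply (is_RInt_le (fun t => / t - 1) h x 1).
  - lra.
  - apply (is_RInt_derive (fun t => ln t - t)).
    + intros t Ht. rewrite Rmin_left in Ht by lra. auto_derive; [lra | ring].
    + intros t Ht. rewrite Rmin_left in Ht by lra.
      apply continuous_ex_derive. auto_derive. lra.
  - apply (RInt_correct (V := R_CompleteNormedModule)), ex_RInt_pos; lra || exact Hc.
  - intros t Ht. unfold h. replace (0 - 1) with (- (1)) by ring.
    rewrite Rpower_Ropp, Rpower_1 by lra.
    replace (/ t - 1) with (/ t * (1 + - t)) by (field; lra).
    apply Rmult_le_compat_l; [left; apply Rinv_0_lt_compat; lra | apply exp_ineq1_le].
Qed.

Lemma G_0_upper (x : R) : 0 < x < 1 -> G 0 x <= 1 - ln x.
Proof.
  intros Hx. unfold G. destruct (Req_EM_T 0 (-1)) as [E|_]; [lra|].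
  destruct (Req_EM_T 0 0) as [_|E]; [|lra].
  rewrite ln_div by lra.
  assert (ln x < ln (x + 1)) by (apply ln_increasing; lra).
  assert (ln (x + 1) <= x).
  { pose proof (exp_ineq1_le (ln (x + 1))) as H'. rewrite exp_ln in H' by lra. lra. }
  pose proof (exp_increasing (- x) 0 ltac:(lra)) as He. rewrite exp_0 in He.
  pose proof (exp_pos (- x)). nra.
Qed.

Lemma filterlim_inv_infty : filterlim Rinv (Rbar_locally p_infty) (locally 0).
Proof. apply (filterlim_Rbar_inv p_infty). discriminate. Qed.

(** Both functions diverge like - ln x. The ratio is squeezed between 1 and (1 - ln x)/(- ln x - 1)
    = 1 + 2/(- ln x - 1); taking x < 1/e keeps the denominator positive. *)
Lemma G_0_exact_at_0 : exact_at_0 0 (G 0).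
Proof.
  unfold exact_at_0.
  apply (filterlim_le_le (fun _ => 1) _ (fun x => 1 + 2 * / (- ln x - 1)) (Finite 1)).
  - pose proof (exp_pos (-1)).
    assert (Hev : at_right 0 (fun x => 0 < x /\ x < exp (-1))).
    { apply filter_and; [apply at_right_gt | now apply at_right_lt]. }
    eapply filter_imp; [|exact Hev]. intros x [Hx Hxe].
    assert (Hln : ln x < -1).
    { apply exp_lt_inv. now rewrite exp_ln. }
    assert (Hx1 : x < 1).
    { apply Rlt_trans with (1 := Hxe). rewrite <- exp_0. apply exp_increasing. lra. }
    pose proof (uGamma_0_lower x ltac:(lra)). pose proof (G_0_upper x ltac:(lra)).
    pose proof (uGamma_lt_G_nonpos 0 x ltac:(lra) Hx).
    split.
    + apply Rmult_le_reg_r with (uGamma 0 x); [lra|].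
      unfold Rdiv. rewrite Rmult_assoc, Rinv_l by lra. lra.
    + apply Rle_trans with (G 0 x / (- ln x - 1)).
      * apply Rmult_le_compat_l; [lra|]. apply Rinv_le_contravar; lra.
      * apply Rmult_le_reg_r with (- ln x - 1); [lra|].
        field_simplify; lra.
  - apply filterlim_const.
  - apply (filterlim_limit_eq _ _ (1 + 2 * 0)); [ring|].
    apply filterlim_Rplus; [typeclasses eauto | apply filterlim_const |].
    apply filterlim_Rmult; [typeclasses eauto | apply filterlim_const |].
    apply (filterlim_comp _ _ _ (fun x => - ln x - 1) Rinv _ (Rbar_locally p_infty)).
    + apply (filterlim_comp _ _ _ ln (fun y => - y - 1) _ (Rbar_locally m_infty)).
      * apply is_lim_ln_0.
      * intros P [M HM]. exists (- M - 1). intros y Hy. apply HM. lra.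
    + exact filterlim_inv_infty.
Qed.

(** * Behaviour at infinity *)

Lemma uGamma_pred_le (a x : R) : 0 < x -> uGamma (a - 1) x <= uGamma a x / x.
Proof.
  intros Hx. left. apply Rmult_lt_reg_l with (exp x); [apply exp_pos|].
  replace (exp x * (uGamma a x / x)) with (/ x * (exp x * uGamma a x)) by (field; lra).
  apply (is_exp_mean_lt (fun t => Rpower (x + t) (a - 1 - 1))
           (fun t => / x * Rpower (x + t) (a - 1))).
  - intros t Ht. apply continuous_Rpower_shift. lra.
  - intros t Ht. apply (continuous_scal_r (V := R_NormedModule) (/ x)).
    apply continuous_Rpower_shift. lra.
  - intros t Ht. rewrite <- (Rpower_pred (x + t) (a - 1)) by lra.
    pose proof (Rpower_pos (x + t) (a - 1 - 1)).
    apply Rmult_lt_reg_l with x; [exact Hx|]. field_simplify; [nra | lra].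
  - now apply is_exp_mean_uGamma.
  - now apply is_exp_mean_scal, is_exp_mean_uGamma.
Qed.

(** By the recurrence, the quotient differs from 1 by a constant multiple of
    [uGamma (a - 1) x / uGamma a x], which lies between 0 and 1/x. *)
Lemma uGamma_asymptotic (a : R) :
  filterlim (fun x => Rpower x (a - 1) * exp (- x) / uGamma a x)
    (Rbar_locally p_infty) (locally 1).
Proof.
  apply (filterlim_ext_loc (fun x => 1 + (- (a - 1)) * (uGamma (a - 1) x / uGamma a x))).
  { exists 0. intros x Hx. pose proof (uGamma_pos a x Hx).
    pose proof (uGamma_rec a x Hx) as E.
    replace (Rpower x (a - 1) * exp (- x)) with (uGamma a x - (a - 1) * uGamma (a - 1) x) by lra.
    field. lra. }
  apply (filterlim_limit_eq _ _ (1 + - (a - 1) * 0)); [ring|].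
  apply filterlim_Rplus; [typeclasses eauto | apply filterlim_const |].
  apply filterlim_Rmult; [typeclasses eauto | apply filterlim_const |].
  apply (filterlim_le_le (fun _ => 0) _ Rinv (Finite 0)).
  - exists 0. intros x Hx. pose proof (uGamma_pos a x Hx). pose proof (uGamma_pos (a - 1) x Hx).
    split.
    + left. now apply Rdiv_lt_0_compat.
    + apply Rmult_le_reg_r with (uGamma a x); [assumption|].
      unfold Rdiv. rewrite Rmult_assoc, Rinv_l, Rmult_1_r by lra.
      rewrite Rmult_comm. now apply uGamma_pred_le.
  - apply filterlim_const.
  - apply filterlim_inv_infty.
Qed.

Lemma exact_at_infty_of_asymptotic (a : R) (B : R -> R) :
  filterlim (fun x => exp x * B x * / Rpower x (a - 1)) (Rbar_locally p_infty) (locally 1) ->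
  exact_at_infty a B.
Proof.
  intros HB.
  apply (filterlim_ext_loc (fun x => (exp x * B x * / Rpower x (a - 1)) *
           (Rpower x (a - 1) * exp (- x) / uGamma a x))).
  { exists 0. intros x Hx. pose proof (uGamma_pos a x Hx). pose proof (Rpower_pos x (a - 1)).
    rewrite exp_Ropp. pose proof (exp_pos x). field. lra. }
  apply (filterlim_limit_eq _ _ (1 * 1)); [ring|].
  apply filterlim_Rmult; [typeclasses eauto | exact HB | apply uGamma_asymptotic].
Qed.

Lemma derivative_at_1_infty (f : R -> R) (l c : R) :
  0 < c -> is_derive f 1 l ->
  filterlim (fun x => (f (1 + c / x) - f 1) / (c / x)) (Rbar_locally p_infty) (locally l).
Proof.
  intros Hc Hd P [eps HP]. apply is_derive_Reals in Hd.
  destruct (Hd eps (cond_pos eps)) as [d Hdelta].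
  (* The increment is c/x, and it is below [d] exactly when x > c/d. *)
  exists (c / d). intros x Hx. apply HP. pose proof (cond_pos d).
  assert (0 < c / d) by (apply Rdiv_lt_0_compat; lra).
  assert (Hx0 : 0 < x) by lra. assert (0 < c / x) by now apply Rdiv_lt_0_compat.
  apply Hdelta; [lra|]. rewrite Rabs_right by lra.
  apply Rmult_lt_reg_r with x; [lra|].
  apply (Rmult_lt_compat_r d) in Hx; [|assumption].
  replace (c / d * d) with c in Hx by (field; lra).
  replace (c / x * x) with c by (field; lra). lra.
Qed.

(** Factoring out x^a leaves a difference quotient of y^a at y = 1 with increment c/x, whose limit
    is [a]. *)
Lemma secant_asymptotic (a c : R) :
  a <> 0 -> 0 < c ->
  filterlim (fun x => (Rpower (x + c) a - Rpower x a) / (a * c) * / Rpower x (a - 1))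
    (Rbar_locally p_infty) (locally 1).
Proof.
  intros Ha Hc.
  apply (filterlim_ext_loc
    (fun x => / a * ((Rpower (1 + c / x) a - Rpower 1 a) / (c / x)))).
  { exists 0. intros x Hx. assert (0 < c / x) by (apply Rdiv_lt_0_compat; lra).
    replace (x + c) with (x * (1 + c / x)) by (field; lra).
    rewrite <- Rpower_mult_distr, <- (Rpower_pred x a) by lra.
    unfold Rpower at 2. rewrite ln_1, Rmult_0_r, exp_0.
    pose proof (Rpower_pos x (a - 1)). field. lra. }
  apply (filterlim_limit_eq _ _ (/ a * (a * Rpower 1 (a - 1)))).
  { unfold Rpower. rewrite ln_1, Rmult_0_r, exp_0. field. exact Ha. }
  apply filterlim_Rmult; [typeclasses eauto | apply filterlim_const |].
  apply (derivative_at_1_infty (fun y => Rpower y a)); [exact Hc|].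
  apply is_derive_Rpower. lra.
Qed.

Lemma G_exact_at_infty (a : R) : exact_at_infty a (G a).
Proof.
  apply exact_at_infty_of_asymptotic.
  destruct (Req_dec a (-1)) as [->|H1]; [|destruct (Req_dec a 0) as [->|H0]].
  - apply (filterlim_ext_loc (fun _ => 1)); [|apply filterlim_const].
    exists 0. intros x Hx. unfold G. destruct (Req_EM_T (-1) (-1)) as [_|E]; [|lra].
    rewrite exp_mul_expN. replace (-1 - 1) with (- (2)) by ring.
    rewrite Rpower_Ropp, (Rpower_INR_pow x 2 2) by (exact Hx || (simpl; ring)). field. lra.
  - apply (filterlim_ext_loc (fun x => (ln (1 + 1 / x) - ln 1) / (1 / x))).
    + exists 0. intros x Hx. unfold G. destruct (Req_EM_T 0 (-1)) as [E|_]; [lra|].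
      destruct (Req_EM_T 0 0) as [_|E]; [|lra].
      rewrite (Rmult_comm (exp (- x))), exp_mul_expN, ln_1.
      replace (0 - 1) with (- (1)) by ring. rewrite Rpower_Ropp, Rpower_1 by exact Hx.
      replace ((x + 1) / x) with (1 + 1 / x) by (field; lra). field. lra.
    + apply derivative_at_1_infty; [lra|]. auto_derive; lra.
  - eapply filterlim_ext; [|exact (secant_asymptotic a (b a) H0 (b_pos a))].
    intros x. simpl. now rewrite exp_mul_G.
Qed.

Lemma filterlim_Rpower_neg_infty (p : R) :
  p < 0 -> filterlim (fun x => Rpower x p) (Rbar_locally p_infty) (locally 0).
Proof.
  intros Hp. unfold Rpower.
  apply (filterlim_comp _ _ _ (fun t => p * ln t) exp _ (Rbar_locally m_infty)).
  - apply (filterlim_comp _ _ _ ln (Rmult p) _ (Rbar_locally p_infty)).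
    + exact is_lim_ln_p.
    + intros P [M HM]. exists (M / p). intros y Hy. apply HM.
      apply (Rmult_lt_gt_compat_neg_l p) in Hy; [|exact Hp].
      replace (p * (M / p)) with M in Hy by (field; lra). lra.
  - apply is_lim_exp_m.
Qed.

(** The secant part gives the limit 1; the additive constant of [g] is killed by x^(1-a), since a >
    1. *)
Lemma g_exact_at_infty (a : R) : 1 < a -> exact_at_infty a (g a).
Proof.
  intros Ha. apply exact_at_infty_of_asymptotic.
  apply (filterlim_ext (fun x => (Rpower (x + 2) a - Rpower x a) / (a * 2) * / Rpower x (a - 1)
           + (Gamma a - Rpower 2 a / (2 * a)) * Rpower x (- (a - 1)))).
  { intros x. rewrite exp_mul_g, Rpower_Ropp. pose proof (Rpower_pos x (a - 1)).
    field. lra. }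
  apply (filterlim_limit_eq _ _ (1 + (Gamma a - Rpower 2 a / (2 * a)) * 0)); [ring|].
  apply filterlim_Rplus; [typeclasses eauto | apply secant_asymptotic; lra |].
  apply filterlim_Rmult; [typeclasses eauto | apply filterlim_const |].
  apply filterlim_Rpower_neg_infty. lra.
Qed.

(** * Conclusion *)

(** After multiplication by e^x the two sides are S(2) + Gamma(a) and S(b_a) + Gamma(a). The sign of
    a - 2 governs both the monotonicity of S and the position of b_a relative to 2, so S(2) < S(b_a)
    either way. *)
Lemma g_lt_G (a x : R) : 1 < a -> a <> 2 -> 0 < x -> g a x < G a x.
Proof.
  intros Ha Ha2 Hx. apply Rmult_lt_reg_l with (exp x); [apply exp_pos|].
  rewrite exp_mul_G, exp_mul_g by lra. pose proof (b_pos a) as Hb.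
  pose proof (b_2_compare a Ha Ha2) as H2.
  pose proof (mean_increment_incr a x Ha Ha2 Hx) as Hinc. simpl in Hinc.
  pose (S := fun t => (Rpower (x + t) a - Rpower x a - Rpower t a) / (a * t)).
  assert (HS : S 2 < S (b a)).
  { destruct (Rlt_or_le (b a) 2) as [H|H].
    - specialize (Hinc (b a) 2 Hb H). fold (S 2) (S (b a)) in Hinc. nra.
    - destruct H as [H|H]; [|rewrite <- H in H2; lra].
      specialize (Hinc 2 (b a) ltac:(lra) H). fold (S 2) (S (b a)) in Hinc. nra. }
  replace ((Rpower (x + b a) a - Rpower x a) / (a * b a)) with (S (b a) + Gamma a).
  - replace ((Rpower (x + 2) a - Rpower x a - Rpower 2 a) / (2 * a)) with (S 2)
      by (unfold S; field; lra). lra.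
  - unfold S. rewrite (Rpower_b_succ a) by lra. field. lra.
Qed.

Lemma G_1 (x : R) : 0 < x -> G 1 x = exp (- x).
Proof.
  intros Hx. pose proof (b_pos 1). apply Rmult_eq_reg_l with (exp x); [|apply Rgt_not_eq, exp_pos].
  rewrite exp_mul_G, !Rpower_1, <- exp_plus, Rplus_opp_r, exp_0 by lra. field. lra.
Qed.

Lemma g_1 (x : R) : 0 < x -> g 1 x = exp (- x).
Proof. intros Hx. unfold g. rewrite !Rpower_1, Gamma_1 by lra. field. Qed.

Lemma Gamma_3 : Gamma 3 = 2.
Proof. replace 3 with (2 + 1) by ring. rewrite Gamma_succ, Gamma_2 by lra. ring. Qed.

Lemma b_2 : b 2 = 2.
Proof.
  unfold b. destruct (Req_EM_T 2 1) as [E|_]; [lra|].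
  replace (1 / (2 - 1)) with 1 by field. replace (2 + 1) with 3 by ring.
  rewrite Gamma_3. apply Rpower_1. lra.
Qed.

Lemma G_2 (x : R) : 0 < x -> G 2 x = exp (- x) * (1 + x).
Proof.
  intros Hx. unfold G.
  destruct (Req_EM_T 2 (-1)) as [E|_]; [lra|]. destruct (Req_EM_T 2 0) as [E|_]; [lra|].
  rewrite b_2, !(Rpower_INR_pow _ 2 2) by (lra || (simpl; ring)). field.
Qed.

Lemma g_2 (x : R) : 0 < x -> g 2 x = exp (- x) * (1 + x).
Proof.
  intros Hx. unfold g.
  rewrite Gamma_2, !(Rpower_INR_pow _ 2 2) by (lra || (simpl; ring)). field.
Qed.

Lemma g_3 (x : R) : 0 < x -> g 3 x = exp (- x) * (2 + 2 * x + x ^ 2).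
Proof.
  intros Hx. unfold g.
  rewrite Gamma_3, !(Rpower_INR_pow _ 3 3) by (lra || (simpl; ring)). field.
Qed.

Lemma uGamma_lt_G (a x : R) :
  -1 <= a -> a < 1 \/ 2 < a -> 0 < x -> uGamma a x < G a x.
Proof.
  intros Ha Ha' Hx. destruct (Rle_or_lt a 0) as [H0|H0].
  - apply uGamma_lt_G_nonpos; lra.
  - pose proof (uGamma_G_compare a x H0 ltac:(lra) ltac:(lra) Hx) as H.
    assert (Hc : 0 < (a - 2) / (a - 1)).
    { destruct Ha' as [Ha'|Ha'].
      - replace ((a - 2) / (a - 1)) with ((2 - a) / (1 - a)) by (field; lra).
        apply Rdiv_lt_0_compat; lra.
      - apply Rdiv_lt_0_compat; lra. }
    replace ((2 - a) / (a - 1)) with (- ((a - 2) / (a - 1))) in H by (field; lra). nra.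
Qed.

Lemma G_lt_uGamma (a x : R) : 1 < a < 2 -> 0 < x -> G a x < uGamma a x.
Proof.
  intros Ha Hx.
  pose proof (uGamma_G_compare a x ltac:(lra) ltac:(lra) ltac:(lra) Hx) as H.
  assert (0 < (2 - a) / (a - 1)) by (apply Rdiv_lt_0_compat; lra). nra.
Qed.

Theorem theorem1p1 (a : R) (ha : -1 <= a) :
  (forall x : R, 0 < x ->
     (a < 1 -> uGamma a x < G a x) /\
     (a = 1 ->
        g a x = G a x /\ G a x = uGamma a x /\ uGamma a x = exp (- x)) /\
     (1 < a < 2 -> g a x < G a x /\ G a x < uGamma a x) /\
     (a = 2 ->
        g a x = G a x /\ G a x = uGamma a x /\
        uGamma a x = exp (- x) * (1 + x)) /\
     (2 < a < 3 -> uGamma a x < g a x /\ g a x < G a x) /\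
     (a = 3 ->
        uGamma a x = g a x /\ g a x = exp (- x) * (2 + 2 * x + x ^ 2) /\
        exp (- x) * (2 + 2 * x + x ^ 2) < G a x) /\
     (3 < a -> g a x < uGamma a x /\ uGamma a x < G a x)) /\
  (0 <= a -> exact_at_0 a (G a) /\ exact_at_infty a (G a)) /\
  (1 <= a -> exact_at_0 a (g a) /\ exact_at_infty a (g a)) /\
  exact_at_infty a (G a).
Proof.
  split; [|split; [|split]].
  - intros x Hx. repeat split.
    + intros H. apply uGamma_lt_G; lra.
    + subst a. now rewrite G_1, g_1.
    + subst a. now rewrite G_1, uGamma_1.
    + subst a. now apply uGamma_1.
    + apply g_lt_G; lra.
    + now apply G_lt_uGamma.
    + subst a. now rewrite G_2, g_2.
    + subst a. now rewrite G_2, uGamma_2.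
    + subst a. now apply uGamma_2.
    + pose proof (uGamma_g_compare a x ltac:(lra) ltac:(lra) Hx). nra.
    + apply g_lt_G; lra.
    + subst a. now rewrite uGamma_3, g_3.
    + subst a. now apply g_3.
    (* The closed form is [uGamma 3 x], so the comparison for [2 < a] applies. *)
    + subst a. rewrite <- uGamma_3 by exact Hx. apply uGamma_lt_G; lra.
    + pose proof (uGamma_g_compare a x ltac:(lra) ltac:(lra) Hx). nra.
    + apply uGamma_lt_G; lra.
  - intros H0. split; [|apply G_exact_at_infty].
    destruct H0 as [H0|<-]; [|apply G_0_exact_at_0].
    apply exact_at_0_of_lim; [exact H0 | now apply G_lim_0].
  - intros H1. split.
    + apply exact_at_0_of_lim; [lra | apply g_lim_0; lra].
    (* At [a = 1] the additive constant no longer decays relative to x^(a-1) = 1, but [g 1] and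
       [uGamma 1] coincide. *)
    + destruct H1 as [H1|<-]; [now apply g_exact_at_infty|].
      apply (filterlim_ext_loc (fun _ => 1)); [|apply filterlim_const].
      exists 0. intros x Hx. rewrite g_1, uGamma_1 by exact Hx.
      field. apply Rgt_not_eq, exp_pos.
  - apply G_exact_at_infty.
Qed.
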